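(* Let $k$ be an algebraically closed field of characteristic zero, let $n\ge 1$, and let $F=k\langle\langle x_1,\ldots,x_n\rangle\rangle$. Let $\Phi\in F_{\overline{\mathrm{cyc}}}$ be a superpotential of order $\geq 3$ such that the Jacobi algebra $\Lambda(F,\Phi)$ is finite dimensional over $k$. Then $\Phi$ is quasi-homogeneous if and only if $\Phi$ is right equivalent to a weighted-homogeneous superpotential of type $(r_1,\ldots,r_n)$ for some rational numbers $r_1,\ldots,r_n$ lying strictly between $0$ and $1/2$. Moreover, in this case, all such types $(r_1,\ldots,r_n)$ agree with each other up to permutations of the indexes $1,\ldots,n$.
   Context: $F=k\langle\langle x_1,\ldots,x_n\rangle\rangle$ is the complete free algebra: its elements are formal series $\sum_w a_w w$ with $w$ running over all words in $x_1,\ldots,x_n$ and $a_w\in k$. Let $\mathfrak m$ be the ideal generated by $x_1,\ldots,x_n$ (series with zero constant term), and for a subspace $U\subseteq F$ let $U^{cl}=\bigcap_{r\ge 0}(U+\mathfrak m^r)$ be its closure in the $\mathfrak m$-adic topology. Let $[F,F]$ be the $k$-span of commutators, $F_{\overline{\mathrm{cyc}}}:=F/[F,F]^{cl}$, and $\pi:F\to F_{\overline{\mathrm{cyc}}}$ the projection. Elements of $F_{\overline{\mathrm{cyc}}}$ are called superpotentials. Order: $\Phi$ has order $\ge r$ if $\Phi\in\pi(\mathfrak m^r)$. Cyclic derivative: $D_i:F\to F$ is the continuous $k$-linear map with $D_i(x_{i_1}\cdots x_{i_p})=\sum_{s:\, i_s=i}x_{i_{s+1}}\cdots x_{i_p}x_{i_1}\cdots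 x_{i_{s-1}}$. It vanishes on $[F,F]^{cl}$, so $D_i\Phi\in F$ is well defined for a superpotential $\Phi$. Jacobi algebra: $J(F,\Phi)$ is the closed two-sided ideal of $F$ generated by $D_1\Phi,\ldots,D_n\Phi$, and $\Lambda(F,\Phi):=F/J(F,\Phi)$. Quasi-homogeneous: let $\Lambda=\Lambda(F,\Phi)$ and $\Lambda_{\overline{\mathrm{cyc}}}=\Lambda/[\Lambda,\Lambda]^{cl}$, where the closure is with respect to the powers of the ideal $\mathfrak m/J(F,\Phi)$ (if $\Lambda$ is finite dimensional this is $\Lambda/[\Lambda,\Lambda]=HH_0(\Lambda)$). $\Phi$ is quasi-homogeneous if its class $[\Phi]$ under the natural map $F_{\overline{\mathrm{cyc}}}\to\Lambda_{\overline{\mathrm{cyc}}}$ is zero, equivalently $\Phi\in\pi(J(F,\Phi))$. Right equivalent: the group $\mathrm{Aut}_k(F)$ of $k$-algebra automorphisms of $F$ (all of which preserve $\mathfrak m$) acts on $F_{\overline{\mathrm{cyc}}}$; two superpotentials are right equivalent if they lie in the same orbit. Weighted-homogeneous: for rational numbers $0<r_1,\ldots,r_n\le 1/2$, a superpotential is weighted-homogeneous of type $(r_1,\ldots,r_n)$ if it has a representative in $F$ which is a linear combination of monomials $x_{i_1}x_{i_2}\cdots x_{i_p}$ with $r_{i_1}+r_{i_2}+\cdots+r_{i_p}=1$. *)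

(* Defs.v *)
From HB Require Import structures.
From mathcomp Require Import all_boot all_order all_algebra.
From mathcomp Require Import boolp classical_sets zify.

Set Implicit Arguments.
Unset Strict Implicit.
Unset Printing Implicit Defensive.

Import GRing.Theory.

Local Open Scope ring_scope.
Local Open Scope classical_set_scope.
Local Open Scope quotient_scope.

(* An algebra over R that may be the zero ring, as can happen for a quotient  *)
(* by an ideal; MathComp's algType imposes 1 != 0.                            *)
Record kalg (R : pzRingType) := KAlg {
  kalg_lmod :> lmodType R;
  kone : kalg_lmod;
  kmul : kalg_lmod -> kalg_lmod -> kalg_lmod;
  kmulA : associative kmul;
  kmul1l : left_id kone kmul;
  kmul1r : right_id kone kmul;
  kmulDl : left_distributive kmul +%R;
  kmulDr : right_distributive kmul +%R;
  kscalerAl : forall (c : R) x y, c *: kmul x y = kmul (c *: x) y;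
  kscalerAr : forall (c : R) x y, c *: kmul x y = kmul x (c *: y)
}.

Lemma kmulBl (R : pzRingType) (A : kalg R) (x y z : A) :
  kmul (x - y) z = kmul x z - kmul y z.
Proof. by rewrite kmulDl -!scaleN1r kscalerAl. Qed.

Lemma kmulBr (R : pzRingType) (A : kalg R) (x y z : A) :
  kmul x (y - z) = kmul x y - kmul x z.
Proof. by rewrite kmulDr -!scaleN1r kscalerAr. Qed.

Definition kalg_of (R : pzRingType) (A : algType R) : kalg R :=
  @KAlg R A 1 *%R (@mulrA A) (@mul1r A) (@mulr1 A) (@mulrDl A) (@mulrDr A)
    (@scalerAl R A) (@scalerAr R A).

Section Submodules.
Variables (R : pzRingType) (V : lmodType R).

Record submodule := Submodule {
  submodule_set :> V -> Prop;
  submodule0 : submodule_set 0;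
  submoduleP : forall (a : R) (x y : V),
    submodule_set x -> submodule_set y -> submodule_set (a *: x + y)
}.

Implicit Type U : submodule.

Lemma submoduleD U x y : U x -> U y -> U (x + y).
Proof. by move=> Ux Uy; rewrite -[x]scale1r; exact: submoduleP. Qed.

Lemma submoduleZ U a x : U x -> U (a *: x).
Proof.
by move=> Ux; rewrite -[_ *: _]addr0; apply: submoduleP => //; exact: submodule0.
Qed.

Lemma submoduleN U x : U x -> U (- x).
Proof. by rewrite -scaleN1r; exact: submoduleZ. Qed.

Lemma submoduleB U x y : U x -> U y -> U (x - y).
Proof. by move=> Ux Uy; apply: submoduleD => //; exact: submoduleN. Qed.

Definition span_set (S : set V) : set V := [set v |
  exists2 s : seq (R * V),
    (forall p, p \in s -> S p.2) & v = \sum_(p <- s) p.1 *: p.2].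

Lemma span_set0 S : span_set S 0.
Proof. by exists [::] => //; rewrite big_nil. Qed.

Lemma span_setP S (a : R) x y :
  span_set S x -> span_set S y -> span_set S (a *: x + y).
Proof.
move=> [s sS ->] [t tS ->].
exists ([seq (a * p.1, p.2) | p <- s] ++ t).
  move=> p; rewrite mem_cat => /orP[/mapP[q qs ->]|/tS//]; exact: (sS q).
rewrite big_cat big_map scaler_sumr; congr (_ + _).
by apply: eq_bigr => p _; rewrite scalerA.
Qed.

Definition span (S : set V) : submodule :=
  Submodule (span_set0 S) (@span_setP S).

Lemma sub_span (S : set V) x : S x -> span S x.
Proof.
move=> Sx; exists [:: (1, x)]; last by rewrite big_seq1 scale1r.
by move=> p; rewrite inE => /eqP ->.
Qed.

Lemma span_min (S : set V) U :
  (forall x, S x -> U x) -> forall x, span S x -> U x.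
Proof.
move=> SU x [s sS ->]; rewrite big_seq; apply: big_ind.
- exact: submodule0.
- exact: submoduleD.
- by move=> p ps; apply: submoduleZ; apply: SU; exact: sS.
Qed.

Definition full_submodule : submodule :=
  @Submodule (fun=> True) I (fun _ _ _ _ _ => I).

Definition finite_dimensional : Prop :=
  exists s : seq V, forall v : V, span [set x | x \in s] v.

End Submodules.

Section QuotientModule.
Variables (R : pzRingType) (V : lmodType R) (U : submodule V).

Definition quot_rel : rel V := fun x y => `[< U (x - y) >].

Lemma quot_rel_equiv : equiv_class_of quot_rel.
Proof.
split=> [x|x y|y x z]; rewrite /quot_rel.
- by apply/asboolP; rewrite subrr; exact: submodule0.
- by apply/asboolP/asboolP => /submoduleN; rewrite opprB.
- move=> /asboolP xy /asboolP yz; apply/asboolP.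
  by rewrite -[x](addrNK y) -addrA; exact: submoduleD.
Qed.

Canonical quot_equiv := EquivRelPack quot_rel_equiv.
Canonical quot_encModRel := defaultEncModRel quot_rel.

Definition quot : Type := {eq_quot quot_rel}.
HB.instance Definition _ : EqQuotient V quot_rel quot := EqQuotient.on quot.
HB.instance Definition _ := Choice.on quot.

Definition qclass (x : V) : quot := \pi_quot x.

Lemma qclass_repr (x : quot) : qclass (repr x) = x.
Proof. exact: reprK. Qed.

Lemma qclass_eq x y : qclass x = qclass y <-> U (x - y).
Proof.
split=> [/eqP|Uxy]; first by rewrite /qclass piE => /asboolP.
by apply/eqP; rewrite /qclass piE; apply/asboolP.
Qed.

Lemma repr_qclass x : U (repr (qclass x) - x).
Proof. by apply/qclass_eq; rewrite qclass_repr. Qed.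

Definition quot_zero : quot := qclass 0.
Definition quot_opp (x : quot) : quot := qclass (- repr x).
Definition quot_add (x y : quot) : quot := qclass (repr x + repr y).
Definition quot_scale (a : R) (x : quot) : quot := qclass (a *: repr x).

Lemma quot_oppE x : quot_opp (qclass x) = qclass (- x).
Proof.
by apply/qclass_eq; rewrite -opprD; apply: submoduleN; exact: repr_qclass.
Qed.

Lemma quot_addE x y : quot_add (qclass x) (qclass y) = qclass (x + y).
Proof.
apply/qclass_eq; rewrite opprD addrACA.
by apply: submoduleD; exact: repr_qclass.
Qed.

Lemma quot_scaleE a x : quot_scale a (qclass x) = qclass (a *: x).
Proof.
by apply/qclass_eq; rewrite -scalerBr; apply: submoduleZ; exact: repr_qclass.
Qed.

Lemma quot_addA : associative quot_add.
Proof.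
move=> x y z; rewrite -(qclass_repr x) -(qclass_repr y) -(qclass_repr z).
by rewrite !quot_addE addrA.
Qed.

Lemma quot_addC : commutative quot_add.
Proof. by move=> x y; rewrite /quot_add addrC. Qed.

Lemma quot_add0 : left_id quot_zero quot_add.
Proof. by move=> x; rewrite -(qclass_repr x) quot_addE add0r. Qed.

Lemma quot_addN : left_inverse quot_zero quot_opp quot_add.
Proof. by move=> x; rewrite -(qclass_repr x) quot_oppE quot_addE addNr. Qed.

HB.instance Definition _ :=
  GRing.isZmodule.Build quot quot_addA quot_addC quot_add0 quot_addN.

Lemma quot_scaleA a b x : quot_scale a (quot_scale b x) = quot_scale (a * b) x.
Proof. by rewrite -(qclass_repr x) !quot_scaleE scalerA. Qed.

Lemma quot_scale1 : left_id 1 quot_scale.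
Proof. by move=> x; rewrite -(qclass_repr x) quot_scaleE scale1r. Qed.

Lemma quot_scaleDr : right_distributive quot_scale +%R.
Proof.
move=> a x y; rewrite -(qclass_repr x) -(qclass_repr y).
rewrite -[X in quot_scale _ X]/(quot_add _ _) -[RHS]/(quot_add _ _).
by rewrite quot_addE !quot_scaleE quot_addE scalerDr.
Qed.

Lemma quot_scaleDl x : {morph quot_scale^~ x : a b / a + b}.
Proof.
move=> a b; rewrite -(qclass_repr x) -[RHS]/(quot_add _ _).
by rewrite !quot_scaleE quot_addE scalerDl.
Qed.

HB.instance Definition _ := GRing.Zmodule_isLmodule.Build R quot
  quot_scaleA quot_scale1 quot_scaleDr quot_scaleDl.

Lemma qclass_is_linear : linear qclass.
Proof.
move=> a x y; rewrite -[RHS]/(quot_add (quot_scale _ _) _).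
by rewrite quot_scaleE quot_addE.
Qed.

HB.instance Definition _ :=
  GRing.isLinear.Build R V quot *:%R qclass qclass_is_linear.

Lemma qclassZ a x : qclass (a *: x) = a *: qclass x.
Proof. exact: linearZ. Qed.

Lemma qclassD x y : qclass (x + y) = qclass x + qclass y.
Proof. exact: raddfD. Qed.

Lemma qclassB x y : qclass (x - y) = qclass x - qclass y.
Proof. exact: raddfB. Qed.

End QuotientModule.

Section Ideals.
Variables (R : pzRingType) (A : kalg R).

Record ideal := Ideal {
  ideal_submodule :> submodule A;
  idealMl : forall a x, ideal_submodule x -> ideal_submodule (kmul a x);
  idealMr : forall a x, ideal_submodule x -> ideal_submodule (kmul x a)
}.

Fixpoint ideal_pow (I : set A) (r : nat) : submodule A :=
  if r is r'.+1 then
    span [set x | exists a b, [/\ I a, ideal_pow I r' b & x = kmul a b]]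
  else full_submodule A.

Section Closure.
Variables (I : set A) (U : submodule A).

Definition adic_closure_set : set A := [set x |
  forall r, exists u v, [/\ U u, ideal_pow I r v & x = u + v]].

Lemma adic_closure_set0 : adic_closure_set 0.
Proof.
move=> r; exists 0, 0; split; [exact: submodule0|exact: submodule0|].
by rewrite addr0.
Qed.

Lemma adic_closure_setP (a : R) x y :
  adic_closure_set x -> adic_closure_set y -> adic_closure_set (a *: x + y).
Proof.
move=> xU yU r; have [u [v [Uu Iv ->]]] := xU r; have [u' [v' [Uu' Iv' ->]]] := yU r.
exists (a *: u + u'), (a *: v + v'); split; [exact: submoduleP|exact: submoduleP|].
by rewrite scalerDr addrACA.
Qed.

Definition adic_closure : submodule A :=
  Submodule adic_closure_set0 adic_closure_setP.

Definition adic_closed : Prop := forall x, adic_closure x -> U x.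

End Closure.

Definition commutators : submodule A :=
  span [set x | exists a b : A, x = kmul a b - kmul b a].

Section ClosedIdeal.
Variables (I S : set A).

Definition closed_ideal_set : set A := [set x |
  forall K : ideal, adic_closed I K -> (forall y, S y -> K y) -> K x].

Lemma closed_ideal_set0 : closed_ideal_set 0.
Proof. by move=> K _ _; exact: submodule0. Qed.

Lemma closed_ideal_setP (a : R) x y :
  closed_ideal_set x -> closed_ideal_set y -> closed_ideal_set (a *: x + y).
Proof. by move=> xK yK K cK SK; apply: submoduleP; [exact: xK|exact: yK]. Qed.

Definition closed_ideal_submodule :=
  Submodule closed_ideal_set0 closed_ideal_setP.

Lemma closed_ideal_setMl a x :
  closed_ideal_submodule x -> closed_ideal_submodule (kmul a x).
Proof. by move=> xK K cK SK; apply: idealMl; exact: xK. Qed.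

Lemma closed_ideal_setMr a x :
  closed_ideal_submodule x -> closed_ideal_submodule (kmul x a).
Proof. by move=> xK K cK SK; apply: idealMr; exact: xK. Qed.

Definition closed_ideal : ideal := Ideal closed_ideal_setMl closed_ideal_setMr.

End ClosedIdeal.

Definition cyc_quot (I : set A) : Type := quot (adic_closure I commutators).
HB.instance Definition _ I := GRing.Lmodule.on (cyc_quot I).

Definition cyc_proj (I : set A) : A -> cyc_quot I :=
  qclass (adic_closure I commutators).

End Ideals.

Section AlgebraMorphism.
Variables (R : pzRingType) (A B : kalg R) (phi : A -> B).
Hypotheses (phi_lin : linear phi)
  (phiM : forall x y, phi (kmul x y) = kmul (phi x) (phi y)).

Let phiD x y : phi (x + y) = phi x + phi y.
Proof. by have := phi_lin 1 x y; rewrite !scale1r. Qed.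

Let phi0 : phi 0 = 0.
Proof. by apply: (addIr (phi 0)); rewrite -phiD !add0r. Qed.

Let phiB x y : phi (x - y) = phi x - phi y.
Proof. by rewrite -scaleN1r addrC phi_lin scaleN1r addrC. Qed.

Lemma span_morph (S : set A) (S' : set B) :
  (forall x, S x -> S' (phi x)) -> forall x, span S x -> span S' (phi x).
Proof.
move=> SS'.
have U0 : span S' (phi 0) by rewrite phi0; exact: submodule0.
have UP a x y : span S' (phi x) -> span S' (phi y) -> span S' (phi (a *: x + y)).
  by move=> Sx Sy; rewrite phi_lin; exact: submoduleP.
apply: (span_min (U := @Submodule R A (fun x => span S' (phi x)) U0 UP)) => x Sx.
by apply: sub_span; exact: SS'.
Qed.

Variables (I : set A) (I' : set B).
Hypothesis II' : forall x, I x -> I' (phi x).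

Lemma ideal_pow_morph r x : ideal_pow I r x -> ideal_pow I' r (phi x).
Proof.
elim: r x => [//|r IHr]; apply: span_morph => _ [a [b [Ia Ib ->]]].
by exists (phi a), (phi b); split; [exact: II'|exact: IHr|].
Qed.

Lemma adic_closure_commutators_morph x :
  adic_closure I (commutators A) x -> adic_closure I' (commutators B) (phi x).
Proof.
move=> xcl r; have [u [v [uc vI ->]]] := xcl r.
exists (phi u), (phi v); split; [|exact: ideal_pow_morph|exact: phiD].
by move: uc; apply: span_morph => _ [a [b ->]]; exists (phi a), (phi b); rewrite phiB !phiM.
Qed.

End AlgebraMorphism.

Section QuotientAlgebra.
Variables (R : pzRingType) (A : kalg R) (K : ideal A).
Local Notation Q := (quot K).

Definition quot_one : Q := qclass K (kone A).
Definition quot_mul (x y : Q) : Q := qclass K (kmul (repr x) (repr y)).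

Lemma quot_mulE x y : quot_mul (qclass K x) (qclass K y) = qclass K (kmul x y).
Proof.
apply/qclass_eq.
rewrite -[X in X - _](addrNK (kmul (repr (qclass K x)) y)) -kmulBr -addrA -kmulBl.
by apply: submoduleD; [apply: idealMl|apply: idealMr]; exact: repr_qclass.
Qed.

Lemma quot_mulA : associative quot_mul.
Proof.
move=> x y z; rewrite -(qclass_repr x) -(qclass_repr y) -(qclass_repr z).
by rewrite !quot_mulE kmulA.
Qed.

Lemma quot_mul1l : left_id quot_one quot_mul.
Proof. by move=> x; rewrite -(qclass_repr x) quot_mulE kmul1l. Qed.

Lemma quot_mul1r : right_id quot_one quot_mul.
Proof. by move=> x; rewrite -(qclass_repr x) quot_mulE kmul1r. Qed.

Lemma quot_mulDl : left_distributive quot_mul +%R.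
Proof.
move=> x y z; rewrite -(qclass_repr x) -(qclass_repr y) -(qclass_repr z).
by rewrite -qclassD !quot_mulE -qclassD kmulDl.
Qed.

Lemma quot_mulDr : right_distributive quot_mul +%R.
Proof.
move=> x y z; rewrite -(qclass_repr x) -(qclass_repr y) -(qclass_repr z).
by rewrite -qclassD !quot_mulE -qclassD kmulDr.
Qed.

Lemma quot_scalerAl (c : R) (x y : Q) :
  c *: quot_mul x y = quot_mul (c *: x) y.
Proof.
rewrite -(qclass_repr x) -(qclass_repr y) -qclassZ.
by rewrite !quot_mulE -qclassZ kscalerAl.
Qed.

Lemma quot_scalerAr (c : R) (x y : Q) :
  c *: quot_mul x y = quot_mul x (c *: y).
Proof.
rewrite -(qclass_repr x) -(qclass_repr y) -qclassZ.
by rewrite !quot_mulE -qclassZ kscalerAr.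
Qed.

Definition quot_alg : kalg R := @KAlg R Q quot_one quot_mul
  quot_mulA quot_mul1l quot_mul1r quot_mulDl quot_mulDr
  quot_scalerAl quot_scalerAr.

End QuotientAlgebra.

Lemma big_triangle (V : nmodType) (T : nat -> nat -> V) N :
  \sum_(0 <= p < N) \sum_(p <= q < N) T p q =
  \sum_(0 <= q < N) \sum_(0 <= p < q.+1) T p q.
Proof.
elim: N => [|N IHN]; first by rewrite !big_geq.
rewrite [RHS]big_nat_recr //= -IHN [X in _ = _ + X]big_nat_recr //= addrA.
rewrite -big_split /= big_nat_recr //= big_nat1; congr (_ + _).
by apply: eq_big_nat => p /andP[_ pN]; rewrite big_nat_recr //= ltnW.
Qed.

Section Series.
Variables (k : fieldType) (n : nat).

(* The value of a series at a word w is the coefficient of w.                 *)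
Definition ncseries : Type := seq 'I_n -> k.
Local Notation F := ncseries.

HB.instance Definition _ := gen_eqMixin F.
HB.instance Definition _ := gen_choiceMixin F.

Implicit Types (f g h : F) (w v : seq 'I_n) (i : 'I_n).

Definition ser_zero : F := fun=> 0.
Definition ser_opp f : F := fun w => - f w.
Definition ser_add f g : F := fun w => f w + g w.
Definition ser_scale (c : k) f : F := fun w => c * f w.
Definition monomial v : F := fun w => (w == v)%:R.
Definition ser_mul f g : F :=
  fun w => \sum_(0 <= j < (size w).+1) f (take j w) * g (drop j w).

Lemma ser_addA : associative ser_add.
Proof. by move=> f g h; apply/funext => w; rewrite /ser_add addrA. Qed.

Lemma ser_addC : commutative ser_add.
Proof. by move=> f g; apply/funext => w; rewrite /ser_add addrC. Qed.

Lemma ser_add0 : left_id ser_zero ser_add.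
Proof. by move=> f; apply/funext => w; rewrite /ser_add add0r. Qed.

Lemma ser_addN : left_inverse ser_zero ser_opp ser_add.
Proof. by move=> f; apply/funext => w; rewrite /ser_add addNr. Qed.

HB.instance Definition _ :=
  GRing.isZmodule.Build F ser_addA ser_addC ser_add0 ser_addN.

Lemma ser_mulA : associative ser_mul.
Proof.
move=> f g h; apply/funext => w; rewrite /ser_mul.
pose T p q := f (take p w) * g (take (q - p) (drop p w)) * h (drop q w).
transitivity (\sum_(0 <= p < (size w).+1) \sum_(p <= q < (size w).+1) T p q).
  apply: eq_big_nat => p /andP[_ pw]; rewrite big_distrr /=.
  rewrite size_drop -subSn // -[RHS]/(\sum_(0 + p <= q < (size w).+1) T p q) big_addn.
  apply: eq_bigr => q _.
  by rewrite /T mulrA addnK drop_drop.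
rewrite big_triangle; apply: eq_big_nat => q /andP[_ qw]; rewrite big_distrl /=.
rewrite size_takel //; apply: eq_big_nat => p /andP[_ pq].
rewrite /T take_takel; last by lia.
by congr (_ * g _ * _); rewrite take_drop subnK //; lia.
Qed.

Lemma ser_mul1l : left_id (monomial [::]) ser_mul.
Proof.
move=> f; apply/funext => w; rewrite /ser_mul big_nat_recl //= big1_seq.
  by rewrite take0 drop0 /monomial eqxx mul1r addr0.
move=> j; rewrite mem_index_iota => /andP[_ /andP[_ jw]].
by rewrite /monomial -size_eq0 size_takel // mul0r.
Qed.

Lemma ser_mul1r : right_id (monomial [::]) ser_mul.
Proof.
move=> f; apply/funext => w; rewrite /ser_mul big_nat_recr //= big1_seq.
  by rewrite take_size drop_size /monomial eqxx mulr1 add0r.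
move=> j; rewrite mem_index_iota => /andP[_ /andP[_ jw]].
by rewrite /monomial -size_eq0 size_drop subn_eq0 leqNgt jw mulr0.
Qed.

Lemma ser_mulDl : left_distributive ser_mul +%R.
Proof.
move=> f g h; apply/funext => w; rewrite -[RHS]/(_ + _) -big_split /=.
by apply: eq_bigr => j _; rewrite mulrDl.
Qed.

Lemma ser_mulDr : right_distributive ser_mul +%R.
Proof.
move=> f g h; apply/funext => w; rewrite -[RHS]/(_ + _) -big_split /=.
by apply: eq_bigr => j _; rewrite mulrDr.
Qed.

Lemma ser_one_neq0 : monomial [::] != 0.
Proof.
apply/eqP => /(congr1 (fun f : F => f [::])) /eqP.
by rewrite /monomial eqxx oner_eq0.
Qed.

HB.instance Definition _ := GRing.Zmodule_isNzRing.Build F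
  ser_mulA ser_mul1l ser_mul1r ser_mulDl ser_mulDr ser_one_neq0.

Lemma ser_scaleA a b f : ser_scale a (ser_scale b f) = ser_scale (a * b) f.
Proof. by apply/funext => w; rewrite /ser_scale mulrA. Qed.

Lemma ser_scale1 : left_id 1 ser_scale.
Proof. by move=> f; apply/funext => w; rewrite /ser_scale mul1r. Qed.

Lemma ser_scaleDr : right_distributive ser_scale +%R.
Proof. by move=> a f g; apply/funext => w; rewrite /ser_scale mulrDr. Qed.

Lemma ser_scaleDl f : {morph ser_scale^~ f : a b / a + b}.
Proof. by move=> a b; apply/funext => w; rewrite /ser_scale mulrDl. Qed.

HB.instance Definition _ := GRing.Zmodule_isLmodule.Build k F
  ser_scaleA ser_scale1 ser_scaleDr ser_scaleDl.

Lemma ser_scalerAl (c : k) f g : c *: (f * g) = (c *: f) * g.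
Proof.
apply/funext => w; rewrite -[LHS]/(c * _) big_distrr /=.
by apply: eq_bigr => j _; rewrite mulrA.
Qed.

HB.instance Definition _ := GRing.Lmodule_isLalgebra.Build k F ser_scalerAl.

Lemma ser_scalerAr (c : k) f g : c *: (f * g) = f * (c *: g).
Proof.
apply/funext => w; rewrite -[LHS]/(c * _) big_distrr /=.
by apply: eq_bigr => j _; rewrite mulrCA.
Qed.

HB.instance Definition _ := GRing.Lalgebra_isAlgebra.Build k F ser_scalerAr.

Lemma serD f g w : (f + g) w = f w + g w. Proof. by []. Qed.
Lemma serN f w : (- f) w = - f w. Proof. by []. Qed.
Lemma serZ (c : k) f w : (c *: f) w = c * f w. Proof. by []. Qed.
Lemma serM f g w :
  (f * g) w = \sum_(0 <= j < (size w).+1) f (take j w) * g (drop j w).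
Proof. by []. Qed.
Lemma ser0E w : (0 : F) w = 0. Proof. by []. Qed.
Lemma ser1E w : (1 : F) w = (w == [::])%:R. Proof. by []. Qed.

Lemma serM_const f g : (f * g) [::] = f [::] * g [::].
Proof. by rewrite serM big_nat1. Qed.

Definition max_ideal : set F := [set f | f [::] = 0].

Definition free_alg : kalg k := kalg_of F.

Lemma max_ideal_pow r f w :
  ideal_pow (A := free_alg) max_ideal r f -> (size w < r)%N -> f w = 0.
Proof.
have v0 s : (fun f : F => forall w, (size w < s)%N -> f w = 0) 0 by [].
have vP s a (x y : F) : (forall w, (size w < s)%N -> x w = 0) ->
    (forall w, (size w < s)%N -> y w = 0) ->
    forall w, (size w < s)%N -> (a *: x + y) w = 0.
  by move=> x0 y0 u us; rewrite serD serZ x0 // y0 // mulr0 addr0.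
move=> rf; move: w; elim: r f rf => [//|r IHr] f.
apply: (span_min (U := @Submodule k F _ (v0 r.+1) (@vP r.+1))) => {}f /=.
move=> [a [b [a0 rb ->]]] w wr; rewrite [LHS]serM big_nat big1 // => -[|j] /andP[_ jw].
  by rewrite take0 a0 mul0r.
by rewrite (IHr b rb) ?mulr0 // size_drop; lia.
Qed.

(* A word v and a position s with v_s = i contribute v_{s+1}..v_p v_1..v_{s-1} *)
(* to D_i(v); this equals w exactly when v = drop j w ++ i :: take j w with    *)
(* j = p - s, whence the coefficient of w.                                     *)
Definition cycder i f : F :=
  fun w => \sum_(0 <= j < (size w).+1) f (drop j w ++ i :: take j w).

Lemma cycder_is_linear i : linear (cycder i).
Proof.
move=> a f g; apply/funext => w; rewrite /cycder serD serZ big_distrr -big_split.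
by apply: eq_bigr.
Qed.

HB.instance Definition _ i :=
  GRing.isLinear.Build k F F *:%R (cycder i) (cycder_is_linear i).

Lemma cycder_monomial i v :
  cycder i (monomial v) =
  \sum_(0 <= s < size v | nth i v s == i) monomial (drop s.+1 v ++ take s v).
Proof.
apply/funext => w; rewrite (@big_morph _ _ (fun f : F => f w) 0 +%R) //.
rewrite /cycder /monomial.
have [vw|vw] := eqVneq (size v) (size w).+1; last first.
  rewrite big_nat big1 => [|j /andP[_ jw]]; last first.
    case: eqP => // vE; move: vw; rewrite -vE size_cat /= size_drop size_takel //.
    by case/eqP; lia.
  rewrite big_nat_cond big1 // => s /andP[/andP[_ sv] _].
  case: eqP => // wE; move: vw; rewrite wE size_cat size_drop size_takel; last exact: ltnW.
  by case/eqP; lia.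
rewrite vw big_nat_rev /= [RHS]big_mkcond /=; apply: eq_big_nat => s /andP[_ sw].
rewrite add0n subSS; set j := (size w - s)%N.
have sj : size (drop j w) = s by rewrite size_drop /j; lia.
case: eqP => [<-|ne].
  rewrite nth_cat sj ltnn subnn /= eqxx take_size_cat // drop_cat sj.
  by rewrite ltnNge leqnSn /= subSnn /= drop0 cat_take_drop !eqxx.
case: eqP => // vi; case: eqP => // wE; case: ne.
have sv : (s < size v)%N by rewrite vw.
have -> : j = size (drop s.+1 v) by rewrite size_drop vw.
rewrite wE drop_size_cat // take_size_cat //.
by rewrite -[in RHS](cat_take_drop s v) (drop_nth i sv) vi.
Qed.

Lemma cycderM i f g : cycder i (f * g) = cycder i (g * f).
Proof.
pose S f g w := \sum_(0 <= p < (size w).+1) \sum_(p <= q < (size w).+1)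
  f (take (q - p) (drop p w)) * g (drop q w ++ i :: take p w).
have E f1 g1 w : cycder i (f1 * g1) w = S f1 g1 w + S g1 f1 w.
  rewrite /S [X in _ + X]big_triangle -big_split /=.
  apply: eq_big_nat => j /andP[_ jw].
  have sz : size (drop j w ++ i :: take j w) = (size w).+1.
    by rewrite size_cat /= size_drop size_takel //; lia.
  rewrite serM sz (@big_cat_nat _ _ _ (size w - j).+1) //=; last by lia.
  congr (_ + _).
    rewrite -[in RHS](add0n j) big_addn add0n subSn //.
    apply: eq_big_nat => c /andP[_ cw]; rewrite addnK.
    rewrite take_cat size_drop drop_cat size_drop.
    have [cj|cj] := ltnP c (size w - j); first by rewrite drop_drop.
    have -> : c = (size w - j)%N by lia.
    rewrite subnn take0 drop0 cats0 subnK; last by rewrite -ltnS.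
    by rewrite drop_size [take _ (drop _ _)]take_oversize ?size_drop.
  rewrite -[(size w - j).+1 in LHS]add0n big_addn.
  have -> : ((size w).+2 - (size w - j).+1 = j.+1)%N by lia.
  apply: eq_big_nat => d /andP[_ dj].
  rewrite take_cat size_drop drop_cat size_drop.
  have -> : (d + (size w - j).+1 < size w - j)%N = false by lia.
  have -> : (d + (size w - j).+1 - (size w - j) = d.+1)%N by lia.
  rewrite /= take_takel; last by lia.
  by rewrite mulrC take_drop subnK //; lia.
by apply/funext => w; rewrite !E addrC.
Qed.

Lemma cycder_closure i f :
  adic_closure (A := free_alg) max_ideal (commutators free_alg) f ->
  cycder i f = 0.
Proof.
move=> fcl; apply/funext => w.
have [u [v [uc vm ->]]] := fcl (size w).+2.
have k0 : (fun f : F => cycder i f = 0) 0 by exact: linear0.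
have kP a (x y : F) : cycder i x = 0 -> cycder i y = 0 -> cycder i (a *: x + y) = 0.
  by move=> x0 y0; rewrite cycder_is_linear x0 y0 scaler0 addr0.
have u0 : cycder i u = 0.
  apply: (span_min (U := @Submodule k F _ k0 kP)) uc => x [a [b ->]] /=.
  by apply/eqP; rewrite raddfB subr_eq0; apply/eqP; exact: cycderM.
have cD (x y : F) : cycder i (x + y) = cycder i x + cycder i y by exact: raddfD.
rewrite [cycder i _](cD u v) u0 add0r /cycder big_nat big1 // => j /andP[_ jw].
apply: (max_ideal_pow vm).
by rewrite size_cat /= size_drop size_takel //; lia.
Qed.

Definition superpotential : Type := @cyc_quot k free_alg max_ideal.
HB.instance Definition _ := GRing.Lmodule.on superpotential.

Definition cproj : F -> superpotential := @cyc_proj k free_alg max_ideal.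

Definition order_ge (r : nat) (Phi : superpotential) : Prop :=
  exists2 f, ideal_pow (A := free_alg) max_ideal r f & Phi = cproj f.

(* The cyclic derivative does not depend on the chosen representative, see    *)
(* superpotential_cycderE.                                                    *)
Definition superpotential_cycder i (Phi : superpotential) : F :=
  cycder i (repr Phi).

Lemma superpotential_cycderE i f :
  superpotential_cycder i (cproj f) = cycder i f.
Proof.
apply/eqP; rewrite -subr_eq0 -raddfB; apply/eqP; apply: cycder_closure.
exact: repr_qclass.
Qed.

Definition jacobi_ideal (Phi : superpotential) : ideal free_alg :=
  closed_ideal (A := free_alg) max_ideal
    [set f | exists i, f = superpotential_cycder i Phi].

Definition jacobi_algebra (Phi : superpotential) : kalg k :=
  quot_alg (jacobi_ideal Phi).

Definition jacobi_proj (Phi : superpotential) : F -> jacobi_algebra Phi :=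
  qclass (jacobi_ideal Phi).

Definition jacobi_max (Phi : superpotential) : set (jacobi_algebra Phi) :=
  jacobi_proj Phi @` max_ideal.

(* The natural map from superpotentials to the cyclic quotient of the Jacobi  *)
(* algebra, see jacobi_classE for independence of the representative.         *)
Definition jacobi_class (Phi Psi : superpotential) :
    cyc_quot (@jacobi_max Phi) :=
  cyc_proj (@jacobi_max Phi) (jacobi_proj Phi (repr Psi)).

Lemma jacobi_classE Phi f :
  jacobi_class Phi (cproj f) = cyc_proj (@jacobi_max Phi) (jacobi_proj Phi f).
Proof.
apply/qclass_eq; rewrite -[X in adic_closure _ _ X](qclassB (jacobi_ideal Phi)).
apply: (@adic_closure_commutators_morph _ free_alg (jacobi_algebra Phi)
  (jacobi_proj Phi) _ _ max_ideal).
- exact: qclass_is_linear.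
- by move=> x y; rewrite -[RHS]/(quot_mul _ _) quot_mulE.
- by move=> x mx; exists x.
- exact: repr_qclass.
Qed.

Definition quasi_homogeneous (Phi : superpotential) : Prop :=
  jacobi_class Phi Phi = 0.

(* The induced action on superpotentials; it does not depend on the           *)
(* representative when s is an algebra morphism, see ser_aut_actE.            *)
Definition ser_aut_act (s : F -> F) (Phi : superpotential) : superpotential :=
  cproj (s (repr Phi)).

Lemma serX_vanish f j w : f [::] = 0 -> (size w < j)%N -> (f ^+ j) w = 0.
Proof.
move=> f0; elim: j w => [//|j IHj] w wj.
rewrite exprS serM big_nat big1 // => -[|i] /andP[_ iw].
  by rewrite take0 f0 mul0r.
by rewrite IHj ?mulr0 // size_drop; lia.
Qed.

Lemma ser_subr1_rinv f : f [::] = 0 -> exists g, (1 - f) * g = 1.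
Proof.
move=> f0; pose S N := \sum_(l < N.+1) f ^+ l.
have sumE m (G : 'I_m -> F) w : (\sum_(i < m) G i) w = \sum_(i < m) G i w.
  by rewrite (@big_morph _ _ (fun f : F => f w) 0 +%R).
exists (fun w => S (size w) w); apply/funext => w.
transitivity (((1 - f) * S (size w)) w).
  apply: eq_big_nat => j /andP[_ jw]; congr (_ * _).
  rewrite /S !sumE -!(big_mkord predT (fun l => (f ^+ l) (drop j w))).
  rewrite [RHS](@big_cat_nat _ _ _ (size (drop j w)).+1) //=; last first.
    by rewrite size_drop; lia.
  rewrite [X in _ + X]big_nat [X in _ + X]big1 ?addr0 // => i /andP[ij _].
  by rewrite serX_vanish.
rewrite -opprB mulNr -subrX1 opprB serD serN serX_vanish //.
by rewrite subr0.
Qed.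

Lemma ser_morph_max_ideal (s : {lrmorphism F -> F}) f :
  max_ideal f -> max_ideal (s f).
Proof.
move=> f0; apply/eqP; apply/negP => /negP c0; set c := s f [::] in c0.
have [g fg1] : exists g, (1 - c^-1 *: f) * g = 1.
  by apply: ser_subr1_rinv; rewrite serZ f0 mulr0.
have sE : s (1 - c^-1 *: f) = 1 - c^-1 *: s f.
  by rewrite -[in RHS](rmorph1 s) -linearZ -raddfB.
have : (s (1 - c^-1 *: f) * s g) [::] = 1 by rewrite -rmorphM fg1 rmorph1 ser1E eqxx.
rewrite serM_const [s (1 - _)]sE serD serN serZ -/c.
rewrite ser1E eqxx mulVf // subrr mul0r => /eqP.
by rewrite eq_sym oner_eq0.
Qed.

Lemma ser_aut_actE (s : {lrmorphism F -> F}) f :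
  ser_aut_act s (cproj f) = cproj (s f).
Proof.
apply/qclass_eq; rewrite -[X in adic_closure _ _ X](raddfB s).
apply: (@adic_closure_commutators_morph _ free_alg free_alg s _ _ max_ideal).
- by move=> a x y; exact: linearP.
- by move=> x y; exact: rmorphM.
- exact: ser_morph_max_ideal.
- exact: repr_qclass.
Qed.

Definition right_equivalent (Phi Psi : superpotential) : Prop :=
  exists2 s : {lrmorphism F -> F}, bijective s & Psi = ser_aut_act s Phi.

Definition weighted_homogeneous (r : 'I_n -> rat) (Phi : superpotential) :
    Prop :=
  (forall i, 0 < r i <= 2^-1) /\
  exists2 f, span [set monomial w | w in [set w | \sum_(i <- w) r i = 1]] f
           & Phi = cproj f.

End Series.

(* Main.v *)
From HB Require Import structures.
Require Import Defs.
From mathcomp Require Import all_boot all_order all_fingroup all_algebra.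
From mathcomp Require Import boolp classical_sets zify ring lra.

Set Implicit Arguments.
Unset Strict Implicit.
Unset Printing Implicit Defensive.

Import GRing.Theory.
Local Open Scope ring_scope.

(** Write [m] for the ideal of series without constant term, [C] for the closure of
    the span of commutators, and let [f] represent the superpotential.

    A quasi-homogeneous superpotential is fixed by a derivation. As the Jacobi ideal
    [J] of [f] contains a power of [m], quasi-homogeneity gives [f = c + u] with [c] in
    [C] and [u] in [J]. Up to commutators every element of [J] is a combination
    [\sum_i g i * cycder i f], the correction terms being absorbed order by order
    ([euler_exists]), and this sum is, up to commutators, the value at [f] of the
    derivation [der g] sending the variable [i] to [g i] ([der_cycder]). So
    [der g f = f] modulo [C]. Such a derivation preserves [J] ([der_Jac]), and in
    characteristic zero a derivation preserving an ideal that is contained in [m] and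
    contains a power of [m] has no constant terms ([euler_mpow1]).

    Generalized eigenvectors of [der g] modulo [m ^ 2] lift to generalized eigenvectors
    modulo every power of [m] ([geigen_coordinates]). In these coordinates the words
    are generalized eigenvectors whose eigenvalue is the sum of the weights of their
    letters, and since [f] is an eigenvector for the eigenvalue [1], only the words of
    weight [1] matter ([weight_one_part]).

    The weights are rational numbers between [0] and [1/2]: restricting to the axis of
    the variable [i], finiteness forces a word made of [a i >= 2] letters [i] and one
    letter [J i] to occur ([axis_monomial]), so [a i * l i + l (J i) = 1] for all [i].
    This linear system is diagonally dominant, hence has a unique solution, which is
    rational ([weight_system_rational]), and an elementary estimate confines it to the
    interval ([weight_system_bound]). Positive weights leave only finitely many words.

    Conversely a weighted-homogeneous superpotential is fixed by its Euler derivation,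
    which can be transported by an automorphism ([weighted_euler]), and being fixed by
    a derivation implies quasi-homogeneity ([euler_quasi_homogeneous]).

    For uniqueness, two weighted-homogeneous forms give two derivations [der g] and
    [der g'] fixing [f] modulo [C], and then so do all
    [der ((1 - t) *: g + t *: g')]. By the above the linear parts of the latter have
    rational eigenvalues for every [t] in [k]. Hence their characteristic polynomials,
    evaluated at a rational number, are polynomials in [t] with rational values only;
    over an algebraically closed field such a polynomial is constant ([pencil_det]).
    So both linear parts have the same characteristic polynomial, whose roots are the
    weights ([weights_unique]). *)

(** * The order filtration *)

Section Filtration.
Variables (k : fieldType) (n : nat).
Local Notation F := (ncseries k n).
Implicit Types (f g h : F) (u v w : seq 'I_n) (r : nat).

Definition mpow_set r f := forall w, (size w < r)%N -> f w = 0.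

Lemma mpow_set0 r : mpow_set r 0. Proof. by []. Qed.

Lemma mpow_setP r a f g : mpow_set r f -> mpow_set r g -> mpow_set r (a *: f + g).
Proof. by move=> fr gr w wr; rewrite serD serZ fr // gr // mulr0 addr0. Qed.

(** The [r]-th power of the maximal ideal, see [ideal_powE]. *)
Definition mpow r : submodule F := Submodule (@mpow_set0 r) (@mpow_setP r).

Arguments mpow : simpl never.

Definition var (i : 'I_n) : F := monomial k [:: i].

Lemma ser_sumE (I : Type) (s : seq I) (P : pred I) (G : I -> F) w :
  (\sum_(i <- s | P i) G i) w = \sum_(i <- s | P i) G i w.
Proof. by rewrite (@big_morph _ _ (fun f : F => f w) 0 +%R). Qed.

Lemma monomial0 : monomial k [::] = 1 :> F. Proof. by []. Qed.

Lemma varM0 i f : (var i * f) [::] = 0.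
Proof. by rewrite serM_const /var /monomial mul0r. Qed.

Lemma varMS i f j w : (var i * f) (j :: w) = (i == j)%:R * f w.
Proof.
rewrite serM big_nat_recl // big_nat_recl //= take0 drop0 /var /monomial.
rewrite mul0r add0r eqseq_cons eqxx andbT eq_sym big_nat big1 ?addr0 // => l lw.
by case: w lw => [|a w] //= _; rewrite eqseq_cons andbF mul0r.
Qed.

Lemma monomial_cons i w : monomial k (i :: w) = var i * monomial k w.
Proof.
apply/funext => -[|j u]; first by rewrite varM0.
by rewrite varMS /monomial eqseq_cons eq_sym; case: eqP; rewrite ?mul1r ?mul0r.
Qed.

Lemma monomial_cat u v : monomial k (u ++ v) = monomial k u * monomial k v.
Proof.
elim: u => [|i u IHu]; first by rewrite monomial0 mul1r.
by rewrite cat_cons !monomial_cons IHu mulrA.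
Qed.

Lemma mpow_le r s f : (r <= s)%N -> mpow s f -> mpow r f.
Proof. by move=> rs fs w wr; apply: fs; exact: leq_trans rs. Qed.

Lemma mpow_0 f : mpow 0 f. Proof. by []. Qed.

Lemma mpow1 f : mpow 1 f <-> f [::] = 0.
Proof. by split=> [->//|f0 [|//]]. Qed.

Lemma mpowM r s f g : mpow r f -> mpow s g -> mpow (r + s) (f * g).
Proof.
move=> fr gs w wrs; rewrite serM big_nat big1 // => j /andP[_ jw].
have [jr|rj] := ltnP j r; first by rewrite fr ?mul0r // size_takel.
by rewrite gs ?mulr0 // size_drop; lia.
Qed.

Lemma mpowMl r f g : mpow r f -> mpow r (g * f).
Proof. by move=> fr; rewrite -[r]add0n; exact: mpowM. Qed.

Lemma mpowMr r f g : mpow r f -> mpow r (f * g).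
Proof. by move=> fr; rewrite -[r]addn0; exact: mpowM. Qed.

Lemma mpow_monomial r w : (r <= size w)%N -> mpow r (monomial k w).
Proof. by move=> rw v vr; rewrite /monomial; case: eqP vr => // ->; lia. Qed.

Lemma mpow_inf f : (forall r, mpow r f) -> f = 0.
Proof. by move=> fr; apply/funext => w; exact: (fr (size w).+1). Qed.

Lemma mpow_sum r (I : Type) (s : seq I) (P : pred I) (G : I -> F) :
  (forall i, P i -> mpow r (G i)) -> mpow r (\sum_(i <- s | P i) G i).
Proof.
move=> Gr; apply: big_ind => //; exact: (@submoduleD _ _ (mpow r)).
Qed.

Definition lquo (i : 'I_n) f : F := fun w => f (i :: w).

(** Splitting off the first letter is what inductions on the order of a series rest on. *)
Lemma lquoE f : f = (f [::])%:A + \sum_i var i * lquo i f.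
Proof.
apply/funext => -[|j w].
  rewrite serD serZ ser1E mulr1 ser_sumE big1 ?addr0 // => i _; exact: varM0.
rewrite serD serZ ser1E mulr0 add0r ser_sumE (bigD1 j) //= varMS eqxx mul1r.
by rewrite big1 ?addr0 // => i /negPf ij; rewrite varMS ij mul0r.
Qed.

Lemma lquo_mpow r i f : mpow r.+1 f -> mpow r (lquo i f).
Proof. by move=> fr w wr; exact: fr. Qed.

Lemma mpow_expand r f : mpow r.+1 f -> f = \sum_i var i * lquo i f.
Proof. by move=> fr; rewrite {1}[f]lquoE fr // scale0r add0r. Qed.

Lemma ideal_powE r f :
  ideal_pow (A := free_alg k n) (@max_ideal k n) r f <-> mpow r f.
Proof.
split; first by move=> fr w wr; apply: max_ideal_pow fr wr.
elim: r f => [//|r IHr] f fr; rewrite (mpow_expand fr).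
apply: (@big_ind _ (ideal_pow (A := free_alg k n) (@max_ideal k n) r.+1)).
- exact: submodule0.
- by move=> x y; exact: submoduleD.
move=> i _; apply: (@Defs.sub_span _ (free_alg k n)); exists (var i), (lquo i f); split=> //.
by apply: IHr; exact: lquo_mpow.
Qed.

Fixpoint words N : seq (seq 'I_n) :=
  if N is N'.+1 then [::] :: [seq i :: w | i <- enum 'I_n, w <- words N'] else [::].

Lemma mem_words N w : (w \in words N) = (size w < N)%N.
Proof.
elim: N w => [|N IHN] [|i w] //=; rewrite inE ?eqxx //=.
rewrite ltnS -IHN; apply/allpairsP/idP => [[[j v] /= [_ vN [_ ->]]] //|wN].
by exists (i, w); rewrite mem_enum.
Qed.

Lemma words_uniq N : uniq (words N).
Proof.
elim: N => [//|N IHN] /=; apply/andP; split.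
  by apply/allpairsP => -[[j v] /= []].
by apply: allpairs_uniq => //; [exact: enum_uniq|move=> [? ?] [? ?] _ _ /= [-> ->]].
Qed.

Definition truncation N f : F := \sum_(w <- words N) f w *: monomial k w.

Lemma sum_words N (G : seq 'I_n -> k) v :
  (forall w, w != v -> G w = 0) ->
  \sum_(w <- words N) G w = if (size v < N)%N then G v else 0.
Proof.
move=> Gv; rewrite -mem_words; case: ifPn => vN.
  by rewrite (bigD1_seq v) ?words_uniq //= big1 ?addr0.
rewrite big1_seq // => w /= wN; apply: Gv.
by apply: contraNneq vN => <-.
Qed.

Lemma truncation_mpow N f : mpow N (f - truncation N f).
Proof.
move=> w wN; rewrite serD serN /truncation ser_sumE (@sum_words N _ w); last first.
  by move=> v /negPf vw; rewrite serZ /monomial eq_sym vw mulr0.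
by rewrite wN serZ /monomial eqxx mulr1 subrr.
Qed.

(** * Continuous linear maps *)

Definition madic_closed (U : submodule F) :=
  forall f, (forall r, exists2 g, U g & mpow r (f - g)) -> U f.

Lemma mpow_closed r : madic_closed (mpow r).
Proof.
move=> f /(_ r) [g gr fg]; rewrite -[f](subrK g).
exact: (@submoduleD _ _ (mpow r)).
Qed.

(** The constant [c] allows for a loss of order: derivations may lower the order by one. *)
Definition ctn (A : F -> F) :=
  linear A /\ exists c, forall r f, mpow (r + c) f -> mpow r (A f).

Section Ctn.
Implicit Types (A B : F -> F).

Lemma linear_map0 A : linear A -> A 0 = 0.
Proof. by move=> lA; have := lA (-1) 0 0; rewrite scaler0 addr0 scaleN1r addNr. Qed.

Lemma linear_mapD A f g : linear A -> A (f + g) = A f + A g.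
Proof. by move=> lA; have := lA 1 f g; rewrite !scale1r. Qed.

Lemma linear_mapZ A a f : linear A -> A (a *: f) = a *: A f.
Proof. by move=> lA; have := lA a f 0; rewrite (linear_map0 lA) !addr0. Qed.

Lemma linear_mapB A f g : linear A -> A (f - g) = A f - A g.
Proof. by move=> lA; rewrite (linear_mapD _ _ lA) -!scaleN1r linear_mapZ. Qed.

Lemma linear_map_sum A (I : Type) (s : seq I) (P : pred I) (G : I -> F) :
  linear A -> A (\sum_(i <- s | P i) G i) = \sum_(i <- s | P i) A (G i).
Proof.
move=> lA; apply: (@big_morph _ _ A 0 +%R 0 +%R); last exact: linear_map0.
by move=> f g; exact: linear_mapD.
Qed.

Lemma ctn_id : ctn id. Proof. by split=> //; exists 0 => r f; rewrite addn0. Qed.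

Lemma ctn0 : ctn (fun=> 0).
Proof. by split=> [a f g|]; [rewrite scaler0 addr0|exists 0]. Qed.

Lemma ctnD A B : ctn A -> ctn B -> ctn (fun f => A f + B f).
Proof.
move=> [lA [c Ac]] [lB [d Bd]]; split=> [a f g|].
  by rewrite lA lB scalerDr addrACA.
exists (c + d)%N => r f fr; apply: (@submoduleD _ _ (mpow r)).
  by apply: Ac; apply: mpow_le fr; lia.
by apply: Bd; apply: mpow_le fr; lia.
Qed.

Lemma ctnZ A a : ctn A -> ctn (fun f => a *: A f).
Proof.
move=> [lA [c Ac]]; split=> [b f g|].
  by rewrite lA scalerDr !scalerA mulrC.
by exists c => r f fr; apply: (@submoduleZ _ _ (mpow r)); exact: Ac.
Qed.

Lemma ctnN A : ctn A -> ctn (fun f => - A f).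
Proof.
move=> cA; have -> : (fun f => - A f) = (fun f => (-1) *: A f).
  by apply/funext => f; rewrite scaleN1r.
exact: ctnZ.
Qed.

Lemma ctn_comp B A : ctn A -> ctn B -> ctn (fun f => A (B f)).
Proof.
move=> [lA [c Ac]] [lB [d Bd]]; split=> [a f g|]; first by rewrite lB lA.
by exists (c + d)%N => r f fr; apply: Ac; apply: Bd; rewrite -addnA.
Qed.

Lemma ctnMl h A : ctn A -> ctn (fun f => h * A f).
Proof.
move=> [lA [c Ac]]; split=> [a f g|]; first by rewrite lA mulrDr scalerAr.
by exists c => r f fr; apply: mpowMl; exact: Ac.
Qed.

Lemma ctnMr h A : ctn A -> ctn (fun f => A f * h).
Proof.
move=> [lA [c Ac]]; split=> [a f g|]; first by rewrite lA mulrDl scalerAl.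
by exists c => r f fr; apply: mpowMr; exact: Ac.
Qed.

Lemma ctn_sum (I : Type) (s : seq I) (A : I -> F -> F) :
  (forall i, ctn (A i)) -> ctn (fun f => \sum_(i <- s) A i f).
Proof.
move=> cA; elim: s => [|i s IHs].
  by under eq_fun do rewrite big_nil; exact: ctn0.
by under eq_fun do rewrite big_cons; apply: ctnD.
Qed.

(** Truncations are finite combinations of words, so the values on words decide where
    a continuous linear map lands. *)
Lemma ctn_in (U : submodule F) A r :
  madic_closed U -> ctn A -> (forall w, (r <= size w)%N -> U (A (monomial k w))) ->
  forall f, mpow r f -> U (A f).
Proof.
move=> cU [lA [c Ac]] AU f fr; apply: cU => s.
exists (A (truncation (s + c) f)); last first.
  by rewrite -linear_mapB //; apply: Ac; exact: truncation_mpow.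
rewrite linear_map_sum //; apply: big_ind => [||w _].
- exact: submodule0.
- exact: submoduleD.
rewrite linear_mapZ //; have [wr|rw] := ltnP (size w) r.
  by rewrite fr // scale0r; exact: submodule0.
by apply: submoduleZ; exact: AU.
Qed.

Lemma ctn_eq A B : ctn A -> ctn B ->
  (forall w, A (monomial k w) = B (monomial k w)) -> forall f, A f = B f.
Proof.
move=> cA cB AB f; apply/eqP; rewrite -subr_eq0; apply/eqP; apply: mpow_inf => r.
apply: (@ctn_in (mpow r) (fun f => A f - B f) 0) => //.
- exact: mpow_closed.
- by apply: ctnD => //; exact: ctnN.
- by move=> w _; rewrite AB subrr.
Qed.

(** The continuous linear map with value [T w] at the word [w]. Cutting the sum off at
    words of length [(size u).+1] is harmless when [T w] has order at least
    [(size w).-1]. *)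
Definition ext (T : seq 'I_n -> F) f : F :=
  fun u => \sum_(w <- words (size u).+2) f w * T w u.

Variables (T : seq 'I_n -> F) (T_mpow : forall w, mpow (size w).-1 (T w)).

Lemma ext_ctn : ctn (ext T).
Proof.
split=> [a f g|].
  apply/funext => u; rewrite serD serZ /ext big_distrr -big_split /=.
  by apply: eq_bigr => w _; rewrite serD serZ mulrDl mulrA.
exists 1%N => r f fr u ur; rewrite /ext big1_seq // => w /andP[_].
rewrite mem_words => wu; rewrite fr ?mul0r //; lia.
Qed.

Lemma ext_monomial w : ext T (monomial k w) = T w.
Proof.
apply/funext => u; rewrite /ext (@sum_words _ _ w); last first.
  by move=> v /negPf vw; rewrite /monomial vw mul0r.
case: ifPn => [_|wu]; first by rewrite /monomial eqxx mul1r.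
by rewrite T_mpow //; lia.
Qed.

End Ctn.
End Filtration.

Arguments mpow : simpl never.
Arguments var {k n} i.
Arguments lquo {k n} i f.
Arguments ctn_id {k n}.

(** * Derivations, substitutions and cyclic derivatives *)

(* Reduces the continuity of an expression to that of its parts. *)
Ltac ctn_step := first
  [ exact: ctn_id | exact: ctn0 | assumption
  | apply: ctnD | apply: ctnN | apply: ctnMl | apply: ctnMr | apply: ctnZ
  | apply: ctn_sum => ? ].

Section Operators.
Variables (k : fieldType) (n : nat).
Local Notation F := (ncseries k n).
Implicit Types (g : 'I_n -> F) (f h b : F) (u v w : seq 'I_n) (r : nat).
Implicit Types (i j : 'I_n).

Fixpoint der_word (g : 'I_n -> F) w : F :=
  if w is i :: w' then g i * monomial k w' + var i * der_word g w' else 0.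

Lemma var_mpow i : mpow k n 1 (var i). Proof. exact: mpow_monomial. Qed.

Lemma der_word_mpow g w : mpow k n (size w).-1 (der_word g w).
Proof.
elim: w => [//|i w IHw] /=; apply: (@submoduleD _ _ (mpow k n (size w))).
  by apply: mpowMl; exact: mpow_monomial.
case: w IHw => [//|j w] /= IHw; rewrite -add1n; apply: mpowM => //.
exact: var_mpow.
Qed.

Definition der (g : 'I_n -> F) : F -> F := ext (der_word g).

Lemma der_ctn g : ctn (der g).
Proof. exact: ext_ctn. Qed.

Lemma der_monomial_cons g i w :
  der g (monomial k (i :: w)) = g i * monomial k w + var i * der g (monomial k w).
Proof. by rewrite /der !ext_monomial //; exact: der_word_mpow. Qed.

Lemma der1 g : der g 1 = 0.
Proof. by rewrite -monomial0 /der ext_monomial //; exact: der_word_mpow. Qed.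

Lemma der_var g i : der g (var i) = g i.
Proof. by rewrite /var der_monomial_cons monomial0 der1 mulr0 addr0 mulr1. Qed.

Lemma derM g f h : der g (f * h) = der g f * h + f * der g h.
Proof.
have dc := der_ctn g.
have varD i : forall f, der g (var i * f) = g i * f + var i * der g f.
  apply: ctn_eq; first by apply: (ctn_comp dc); repeat ctn_step.
    by repeat ctn_step.
  by move=> w; rewrite -monomial_cons der_monomial_cons.
move: f; apply: ctn_eq; first by apply: (ctn_comp dc); repeat ctn_step.
  by repeat ctn_step.
elim=> [|i w IHw]; first by rewrite monomial0 der1 !mul1r mul0r add0r.
by rewrite der_monomial_cons monomial_cons -mulrA varD IHw mulrDl mulrDr !mulrA addrA.
Qed.

Lemma der_mpow g r f : (forall i, mpow k n 1 (g i)) -> mpow k n r f -> mpow k n r (der g f).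
Proof.
move=> g1; apply: ctn_in; [exact: mpow_closed|exact: der_ctn|].
move=> w rw; apply: (mpow_le rw); elim: w {rw} => [//|i w IHw].
rewrite der_monomial_cons /= -add1n.
apply: (@submoduleD _ _ (mpow _ _ _)); apply: mpowM => //; first exact: mpow_monomial.
exact: var_mpow.
Qed.

Lemma der_mpowS g r f : mpow k n r.+1 f -> mpow k n r (der g f).
Proof.
apply: ctn_in; [exact: mpow_closed|exact: der_ctn|].
move=> [//|i w] /= rw; rewrite ltnS in rw; rewrite /der ext_monomial; last exact: der_word_mpow.
exact: mpow_le rw (@der_word_mpow g (i :: w)).
Qed.

(** A derivation is automatically continuous, as it lowers the order by at most one,
    hence determined by its values on the variables. *)
Lemma derivation_der (d : F -> F) :
  linear d -> (forall f h, d (f * h) = d f * h + f * d h) ->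
  forall f, d f = der (fun i => d (var i)) f.
Proof.
move=> ld dM; have d1 : d 1 = 0.
  by apply: (addrI (d 1)); rewrite addr0 -{3}[1]mulr1 dM mulr1 mul1r.
apply: ctn_eq; last 2 first.
- exact: der_ctn.
- elim=> [|i w IHw]; first by rewrite monomial0 d1 der1.
  by rewrite der_monomial_cons monomial_cons dM IHw.
split=> //; exists 1%N => r f; rewrite addn1.
elim: r f => [//|r IHr] f fr; rewrite (mpow_expand fr) linear_map_sum //.
apply: mpow_sum => i _; rewrite dM; have ir := lquo_mpow i fr.
apply: (@submoduleD _ _ (mpow _ _ _)); first by apply: mpowMl.
by rewrite -add1n; apply: mpowM; [exact: var_mpow|exact: IHr].
Qed.

Lemma der_comb g g' (a b : k) f :
  der (fun i => a *: g i + b *: g' i) f = a *: der g f + b *: der g' f.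
Proof.
move: f; apply: ctn_eq; first exact: der_ctn.
  by repeat ctn_step; exact: der_ctn.
elim=> [|i w IHw]; first by rewrite monomial0 !der1 !scaler0 addr0.
rewrite !der_monomial_cons IHw mulrDl mulrDr !scalerDr addrACA.
by rewrite -!scalerAl -!scalerAr.
Qed.

Lemma subst_exists (y : 'I_n -> F) : (forall i, mpow k n 1 (y i)) ->
  exists s : {lrmorphism F -> F}, forall i, s (var i) = y i.
Proof.
move=> y1; pose T w : F := \prod_(i <- w) y i.
have Tm w : mpow k n (size w) (T w).
  elim: w => [//|i w IHw]; rewrite /T big_cons /= -add1n; exact: mpowM.
have Tp w : mpow k n (size w).-1 (T w) by apply: mpow_le (Tm w); lia.
have sc : ctn (ext T) by exact: ext_ctn.
have lin : linear (ext T) by case: sc.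
have s1 : ext T 1 = 1 by rewrite -{1}monomial0 ext_monomial // /T big_nil.
have sM : {morph ext T : f h / f * h}.
  move=> f h; move: f.
  apply: ctn_eq; first by apply: (ctn_comp sc); repeat ctn_step.
    by repeat ctn_step.
  move=> u; move: h.
  apply: ctn_eq; first by apply: (ctn_comp sc); repeat ctn_step.
    by repeat ctn_step.
  by move=> w; rewrite -monomial_cat !ext_monomial // /T big_cat.
pose L := GRing.isLinear.Build k F F *:%R (ext T) lin.
pose M := GRing.isMonoidMorphism.Build F F (ext T) (s1, sM).
pose s : {lrmorphism F -> F} := HB.pack (ext T) L M.
by exists s => i; rewrite /= ext_monomial // /T big_seq1.
Qed.

End Operators.

Section CyclicDerivatives.
Variables (k : fieldType) (n : nat).
Local Notation F := (ncseries k n).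
Implicit Types (g : 'I_n -> F) (f h b : F) (u v w : seq 'I_n) (r : nat).
Implicit Types (i j : 'I_n).

(** The sum of [v * b * u] over the decompositions [w = u ++ j :: v]: a cyclic
    derivative with a series inserted at the junction, [cycder j] being the case
    [b = 1]. Unlike [cycder j], it satisfies recursions along words. *)
Fixpoint dc_word j w b : F :=
  if w is i :: w' then
    (i == j)%:R *: (monomial k w' * b) + dc_word j w' (b * var i)
  else 0.

Lemma dc_word_mpow_gen j w b s :
  mpow k n s b -> mpow k n ((size w).-1 + s) (dc_word j w b).
Proof.
elim: w b s => [//|i w IHw] b s bs.
apply: (@submoduleD _ _ (mpow _ _ _)).
  by apply: (@submoduleZ _ _ (mpow _ _ _)); apply: mpowM => //; exact: mpow_monomial.
have := IHw (b * var i) s.+1; rewrite -addn1 => /(_ (mpowM bs (var_mpow k i))).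
case: w {IHw} => [//|j' w] /=; apply: mpow_le; lia.
Qed.

Lemma dc_word_mpow j b w : mpow k n (size w).-1 (dc_word j w b).
Proof. by rewrite -[X in mpow _ _ X]addn0; exact: dc_word_mpow_gen. Qed.

Definition dc j f b : F := ext (fun w => dc_word j w b) f.

Lemma dc_monomial j w b : dc j (monomial k w) b = dc_word j w b.
Proof. by rewrite /dc ext_monomial // => v; exact: dc_word_mpow. Qed.

Lemma dc_ctnl j b : ctn (fun f => dc j f b).
Proof. by apply: ext_ctn => w; exact: dc_word_mpow. Qed.

Lemma dc_mpow j f b s : mpow k n s b -> mpow k n s (dc j f b).
Proof.
move=> bs; move: f (mpow_0 f).
apply: ctn_in; [exact: mpow_closed|exact: dc_ctnl|move=> w _].
by rewrite dc_monomial; apply: mpow_le (@dc_word_mpow_gen j w b s bs); lia.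
Qed.

Lemma dc_linear j f : linear (dc j f).
Proof.
move=> a b c; move: f; apply: ctn_eq.
- exact: dc_ctnl.
- by repeat ctn_step; exact: dc_ctnl.
move=> w; rewrite !dc_monomial.
elim: w b c => [|i w IHw] b c /=; first by rewrite scaler0 addr0.
rewrite !mulrDl -scalerAl IHw mulrDr !scalerDr addrACA; congr (_ + _ + _).
by rewrite -scalerAr !scalerA mulrC.
Qed.

Lemma dc_ctnr j f : ctn (dc j f).
Proof.
by split; [exact: dc_linear|exists 0%N => r b; rewrite addn0; exact: dc_mpow].
Qed.

Lemma dc1 j b : dc j 1 b = 0.
Proof. by rewrite -monomial0 dc_monomial. Qed.

Lemma dc_var j i b : dc j (var i) b = (i == j)%:R *: b.
Proof. by rewrite /var dc_monomial /= monomial0 mul1r addr0. Qed.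

(** Cyclic derivatives along a product: the letter removed lies in one of the factors. *)
Lemma dcM j f h b : dc j (f * h) b = dc j f (h * b) + dc j h (b * f).
Proof.
have varD i c : forall f, dc j (var i * f) c =
    (i == j)%:R *: (f * c) + dc j f (c * var i).
  apply: ctn_eq.
  - by apply: (ctn_comp (dc_ctnl j c)); repeat ctn_step.
  - by repeat ctn_step; exact: dc_ctnl.
  by move=> w; rewrite -monomial_cons !dc_monomial.
move: f; apply: ctn_eq.
- by apply: (ctn_comp (dc_ctnl j b)); repeat ctn_step.
- apply: ctnD; first exact: dc_ctnl.
  by apply: (ctn_comp (dc_ctnr j h)); repeat ctn_step.
move=> w; elim: w b => [|i w IHw] b.
  by rewrite monomial0 mul1r mulr1 dc1 add0r.
by rewrite monomial_cons -mulrA !varD IHw addrA !mulrA.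
Qed.

(** Differentiating [v * b * u], where [f = u ++ j :: v], misses the letter [j] removed;
    conversely, a letter [j] may be created by [der g], inside the value [g i] that
    replaces a letter [i]. The last sum corrects for the second effect. *)
Lemma der_dc g j f b :
  der g (dc j f b) =
  dc j (der g f) b + dc j f (der g b) - \sum_i dc j (g i) (dc i f b).
Proof.
have dgc := der_ctn g.
move: f; apply: ctn_eq.
- exact: ctn_comp dgc (dc_ctnl j b).
- apply: ctnD; first apply: ctnD.
  + exact: ctn_comp (dc_ctnl j b) dgc.
  + exact: dc_ctnl.
  + apply: ctnN; apply: ctn_sum => i; exact: (ctn_comp (dc_ctnr j (g i)) (dc_ctnl i b)).
have lr i h := dc_linear i h; have ld := dgc.1.
move=> w; elim: w b => [|i w IHw] b.
  rewrite monomial0 der1 !dc1 (linear_map0 ld) (linear_map0 (dc_ctnl j b).1).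
  rewrite big1 ?subr0 ?addr0 // => i _.
  by rewrite dc1 (linear_map0 (lr _ _)).
have dcl c f h : dc j (f + h) c = dc j f c + dc j h c.
  exact: linear_mapD (dc_ctnl j c).1.
have sumE : \sum_l dc j (g l) (dc l (monomial k (i :: w)) b) =
    dc j (g i) (monomial k w * b) +
    \sum_l dc j (g l) (dc l (monomial k w) (b * var i)).
  under eq_bigr => l _ do
    rewrite monomial_cons dcM dc_var (linear_mapD _ _ (lr _ _)) (linear_mapZ _ _ (lr _ _)).
  rewrite big_split /=; congr (_ + _).
  rewrite (bigD1 i) //= eqxx scale1r big1 ?addr0 // => l /negPf li.
  by rewrite eq_sym li scale0r.
rewrite sumE der_monomial_cons dcl !monomial_cons !dcM !dc_var.
rewrite (linear_mapD _ _ ld) (linear_mapZ _ _ ld) IHw !derM der_var.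
rewrite (linear_mapD _ _ (lr j (monomial k w))) scalerDr.
set A := dc j (g i) _; set B := \sum_l _.
set c1 := _ *: (der g (monomial k w) * b); set c2 := _ *: (monomial k w * der g b).
set d1 := dc j (der g _) _; set d2 := dc j _ (der g b * _); set d3 := dc j _ (b * _).
by apply/funext => u; rewrite !(serD, serN); ring.
Qed.

End CyclicDerivatives.

Section Jacobi.
Variables (k : fieldType) (n : nat).
Local Notation F := (ncseries k n).
Implicit Types (g : 'I_n -> F) (f h b : F) (u v w : seq 'I_n) (r : nat).
Implicit Types (i j : 'I_n).

Lemma lrm_mpow (s : {lrmorphism F -> F}) r f : mpow k n r f -> mpow k n r (s f).
Proof.
elim: r f => [//|r IHr] f fr; rewrite (mpow_expand fr) raddf_sum.
apply: mpow_sum => i _; rewrite /= rmorphM -add1n; apply: mpowM.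
  by apply/mpow1; apply: ser_morph_max_ideal.
by apply: IHr; exact: lquo_mpow.
Qed.

Lemma lrm_ctn (s : {lrmorphism F -> F}) : ctn s.
Proof.
split=> [a f g|]; first exact: linearP.
by exists 0%N => r f; rewrite addn0; exact: lrm_mpow.
Qed.

(** The chain rule: the letter [j] removed from [s f] lies in the image of some letter
    [i] of [f]. *)
Lemma lrm_dc (s : {lrmorphism F -> F}) j f b :
  dc j (s f) (s b) = \sum_i dc j (s (var i)) (s (dc i f b)).
Proof.
have sc := lrm_ctn s; have lr i h := dc_linear i h.
move: f; apply: ctn_eq.
- exact: ctn_comp (dc_ctnl j (s b)) sc.
- apply: ctn_sum => i.
  exact: ctn_comp (dc_ctnr j (s (var i))) (ctn_comp sc (dc_ctnl i b)).
move=> w; elim: w b => [|i w IHw] b.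
  rewrite monomial0 rmorph1 dc1 big1 // => i _.
  by rewrite dc1 raddf0 (linear_map0 (lr _ _)).
rewrite monomial_cons rmorphM dcM -!rmorphM IHw.
under [in RHS]eq_bigr => l _ do
  rewrite dcM dc_var (linear_mapD _ _ sc.1) (linear_mapZ _ _ sc.1) (linear_mapD _ _ (lr _ _)) (linear_mapZ _ _ (lr _ _)).
rewrite big_split /=; congr (_ + _).
rewrite (bigD1 i) //= eqxx scale1r big1 ?addr0 // => l /negPf li.
by rewrite eq_sym li scale0r.
Qed.

Lemma cycder_mpow r j f : mpow k n r.+1 f -> mpow k n r (cycder j f).
Proof.
move=> fr w wr; rewrite /cycder big_nat big1 // => l /andP[_ lw].
by apply: fr; rewrite size_cat /= size_drop size_takel //; lia.
Qed.

Lemma dc_word_monomial j w v :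
  dc_word j w (monomial k v) =
  \sum_(0 <= s < size w | nth j w s == j) monomial k (drop s.+1 w ++ v ++ take s w).
Proof.
elim: w v => [|i w IHw] v; first by rewrite big_geq.
rewrite /= /var -!monomial_cat IHw [RHS]big_mkcond big_nat_recl //= [in LHS]big_mkcond /=.
rewrite drop0 cats0; congr (_ + _); first by case: eqP; rewrite ?scale1r ?scale0r.
by apply: eq_bigr => s _; rewrite -catA.
Qed.

Lemma cycderE j f : cycder j f = dc j f 1.
Proof.
move: f; apply: ctn_eq.
- split; first exact: cycder_is_linear.
  by exists 1%N => r f; rewrite addn1; exact: cycder_mpow.
- exact: dc_ctnl.
move=> w; rewrite cycder_monomial dc_monomial -monomial0 dc_word_monomial.
by [].
Qed.

End Jacobi.

Section Superpotentials.
Variables (k : fieldType) (n : nat).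
Local Notation F := (ncseries k n).
Implicit Types (g : 'I_n -> F) (f h b : F) (u v w : seq 'I_n) (r : nat).
Implicit Types (i j : 'I_n) (U V : submodule F).

Definition cyc0 : submodule F :=
  adic_closure (A := free_alg k n) (@max_ideal k n) (commutators (free_alg k n)).

Arguments cyc0 : simpl never.

Lemma cyc0_closed : madic_closed cyc0.
Proof.
move=> f fU r; have [h hU fh] := fU r; have [c [v [cc vr hE]]] := hU r.
exists c, (v + (f - h)); split=> //.
  apply: submoduleD => //; exact/ideal_powE.
by rewrite addrA -[c + v]hE addrC subrK.
Qed.

Lemma cyc0_comm f h : cyc0 (f * h - h * f).
Proof.
move=> r; exists (f * h - h * f), 0; split.
- by apply: (@Defs.sub_span _ (free_alg k n)); exists f, h.
- exact: submodule0.
- by rewrite addr0.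
Qed.

Lemma cyc0_min U : madic_closed U -> (forall f h, U (f * h - h * f)) ->
  forall f, cyc0 f -> U f.
Proof.
move=> cU commU f fC; apply: cU => r; have [c [v [cc vr ->]]] := fC r.
exists c; last by rewrite addrC addKr; exact/ideal_powE.
by apply: span_min cc => _ [x [y ->]]; exact: commU.
Qed.

Definition preim_set (A : F -> F) (lA : linear A) U f := U (A f).

Lemma preim_set0 A (lA : linear A) U : preim_set lA U 0.
Proof. by rewrite /preim_set (linear_map0 lA); exact: submodule0. Qed.

Lemma preim_setP A (lA : linear A) U a f h :
  preim_set lA U f -> preim_set lA U h -> preim_set lA U (a *: f + h).
Proof. by rewrite /preim_set lA; exact: submoduleP. Qed.

Definition preim A (lA : linear A) U : submodule F :=
  Submodule (preim_set0 lA U) (@preim_setP A lA U).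

Lemma preim_closed A (cA : ctn A) U : madic_closed U -> madic_closed (preim cA.1 U).
Proof.
case: (cA.2) => c Ac cU f fU; apply: cU => r; have [h hU fh] := fU (r + c)%N.
by exists (A h) => //; rewrite -(linear_mapB _ _ cA.1); exact: Ac.
Qed.

Lemma der_cyc0 g f : cyc0 f -> cyc0 (der g f).
Proof.
apply: (cyc0_min (U := preim (der_ctn g).1 cyc0)).
  by apply: preim_closed; exact: cyc0_closed.
move=> a b; rewrite /= /preim_set (linear_mapB _ _ (der_ctn g).1) !derM.
have -> : der g a * b + a * der g b - (der g b * a + b * der g a) =
    (der g a * b - b * der g a) + (a * der g b - der g b * a).
  by apply/funext => u; rewrite !(serD, serN); ring.
by apply: (@submoduleD _ _ cyc0); exact: cyc0_comm.
Qed.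

Lemma lrm_cyc0 (s : {lrmorphism F -> F}) f : cyc0 f -> cyc0 (s f).
Proof.
apply: (cyc0_min (U := preim (lrm_ctn s).1 cyc0)).
  by apply: preim_closed; exact: cyc0_closed.
by move=> a b; rewrite /= /preim_set raddfB /= !rmorphM; exact: cyc0_comm.
Qed.

Lemma cycder_cyc0 i f : cyc0 f -> cycder i f = 0.
Proof. exact: cycder_closure. Qed.

Lemma cproj_eq f h : cproj f = cproj h <-> cyc0 (f - h).
Proof. exact: (@qclass_eq _ (free_alg k n) cyc0). Qed.

Lemma cycderB i f h : cycder i (f - h) = cycder i f - cycder i h.
Proof. exact: raddfB. Qed.

(** Up to rotation, a derivation moves the letter it hits to the front. *)
Lemma der_cycder g f : cyc0 (der g f - \sum_i g i * cycder i f).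
Proof.
under eq_bigr => i _ do rewrite cycderE.
rewrite -[der g f]mulr1; set b : F := 1; move: (b) f => {}b f.
pose A f := der g f * b - \sum_i g i * dc i f b.
change (cyc0 (A f)); move: f (mpow_0 f).
have dgc := der_ctn g.
apply: (ctn_in cyc0_closed).
  by repeat ctn_step; exact: dc_ctnl.
move=> w _; rewrite /A {A}; elim: w b => [|i w IHw] b.
  rewrite monomial0 der1 mul0r big1 ?subrr; first exact: submodule0.
  by move=> i _; rewrite dc1 mulr0.
rewrite der_monomial_cons.
under eq_bigr => l _ do rewrite monomial_cons dcM dc_var mulrDr.
rewrite big_split /= (bigD1 i) //= eqxx scale1r big1 ?addr0; last first.
  by move=> l /negPf li; rewrite eq_sym li scale0r mulr0.
set x := der g (monomial k w).
have -> : (g i * monomial k w + var i * x) * b -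
    (g i * (monomial k w * b) + \sum_l g l * dc l (monomial k w) (b * var i)) =
  (var i * (x * b) - (x * b) * var i) +
  (x * (b * var i) - \sum_l g l * dc l (monomial k w) (b * var i)).
  rewrite mulrDl !mulrA.
  by apply/funext => u; rewrite !(serD, serN); ring.
by apply: (@submoduleD _ _ cyc0); [exact: cyc0_comm|exact: IHw].
Qed.

(** * Jacobi ideals *)

Definition Jac f : submodule F := jacobi_ideal (cproj f).

Arguments Jac : simpl never.

Lemma Jac_cycder f i : Jac f (cycder i f).
Proof. by move=> K _; apply; exists i; rewrite superpotential_cycderE. Qed.

Lemma JacMl f a h : Jac f h -> Jac f (a * h).
Proof. exact: (@Defs.idealMl _ _ (jacobi_ideal (cproj f)) a h). Qed.

Lemma JacMr f a h : Jac f h -> Jac f (h * a).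
Proof. exact: (@Defs.idealMr _ _ (jacobi_ideal (cproj f)) a h). Qed.

Lemma Jac_closed f : madic_closed (Jac f).
Proof.
move=> h hJ K cK SK; apply: (cK) => r; have [h' h'J hh'] := hJ r.
exists h', (h - h'); split; last by rewrite addrC subrK.
- exact: h'J K cK SK.
- exact/ideal_powE.
Qed.

(** The universal property of the Jacobi ideal, for submodules that are two-sided ideals. *)
Lemma Jac_min f U : madic_closed U ->
  (forall a h, U h -> U (a * h)) -> (forall a h, U h -> U (h * a)) ->
  (forall i, U (cycder i f)) -> forall h, Jac f h -> U h.
Proof.
move=> cU Ul Ur Uf h.
pose K : ideal (free_alg k n) := @Ideal _ (free_alg k n) U Ul Ur.
move=> hJ; have hJK := hJ K; apply: hJK.
  move=> x xU; apply: cU => r; have [y [z [yU zr ->]]] := xU r.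
  by exists y => //; rewrite addrC addKr; exact/ideal_powE.
by move=> _ [i ->]; rewrite superpotential_cycderE; exact: Uf.
Qed.

(** On words, [dc j] multiplies its last argument on both sides. *)
Lemma dc_ideal U j a h : madic_closed U ->
  (forall a h, U h -> U (a * h)) -> (forall a h, U h -> U (h * a)) ->
  U h -> U (dc j a h).
Proof.
move=> cU Ul Ur hU; move: a (mpow_0 a).
apply: (ctn_in cU (dc_ctnl j h)) => w _; rewrite dc_monomial.
elim: w h hU => [|i w IHw] h hU /=; first exact: submodule0.
by apply: submoduleD; [apply: submoduleZ; exact: Ul|apply: IHw; exact: Ur].
Qed.

Lemma Jac_dc f j a h : Jac f h -> Jac f (dc j a h).
Proof. by apply: dc_ideal; [exact: Jac_closed|exact: JacMl|exact: JacMr]. Qed.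

Definition capU_set U V f := U f /\ V f.

Lemma capU_set0 U V : capU_set U V 0.
Proof. by split; [exact: (submodule0 U)|exact: (submodule0 V)]. Qed.

Lemma capU_setP U V a f h : capU_set U V f -> capU_set U V h -> capU_set U V (a *: f + h).
Proof. by move=> [Uf Vf] [Uh Vh]; split; [exact: (@submoduleP _ _ U)|exact: (@submoduleP _ _ V)]. Qed.

Definition capU U V : submodule F := Submodule (capU_set0 U V) (@capU_setP U V).

Lemma capU_closed U V : madic_closed U -> madic_closed V -> madic_closed (capU U V).
Proof.
by move=> cU cV f fUV; split; [apply: cU|apply: cV] => r;
  have [h [Uh Vh] fh] := fUV r; exists h.
Qed.

(** If [der g f = f] up to commutators then [der g] sends [cycder i f] to itself up to
    terms [dc i (g l) (cycder l f)], by [der_dc], and these lie in the Jacobi ideal. *)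
Lemma der_Jac g f h : cyc0 (der g f - f) -> Jac f h -> Jac f (der g h).
Proof.
move=> gf; have dgc := der_ctn g; have Jc := @Jac_closed f.
move=> /(Jac_min (U := capU (Jac f) (preim dgc.1 (Jac f)))) [] //.
- by apply: capU_closed => //; exact: preim_closed.
- move=> a x [Jx Jgx]; split; first exact: JacMl.
  by rewrite /= /preim_set derM; apply: (@submoduleD _ _ (Jac f)); exact: JacMl.
- move=> a x [Jx Jgx]; split; first exact: JacMr.
  by rewrite /= /preim_set derM; apply: (@submoduleD _ _ (Jac f)); exact: JacMr.
move=> i; split; first exact: Jac_cycder.
rewrite /= /preim_set cycderE der_dc der1.
rewrite (linear_map0 (dc_ctnr _ _).1) addr0 -cycderE.
have -> : cycder i (der g f) = cycder i f.
  by apply/eqP; rewrite -subr_eq0 -cycderB; apply/eqP; exact: cycder_cyc0.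
apply: (@submoduleB _ _ (Jac f)); first exact: Jac_cycder.
apply: (@big_ind _ (Jac f)).
- exact: (submodule0 (Jac f)).
- by move=> x y; exact: (@submoduleD _ _ (Jac f)).
by move=> l _; apply: Jac_dc; rewrite -cycderE; exact: Jac_cycder.
Qed.

End Superpotentials.

Arguments cyc0 : simpl never.
Arguments Jac : simpl never.

(** * Finite-dimensional Jacobi algebras and Euler derivations *)

Section Dependence.
Variables (k : fieldType) (V : lmodType k).

(** Vectors outnumbering a family that spans them modulo [U] are dependent modulo [U]. *)
Lemma linear_dependence (U : submodule V) d (e : 'I_d -> V) (v : 'I_d.+1 -> V) :
  (forall i, exists c : 'I_d -> k, U (v i - \sum_j c j *: e j)) ->
  exists2 c : 'I_d.+1 -> k, (exists i, c i != 0) & U (\sum_i c i *: v i).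
Proof.
move=> /choice[C CU]; pose A := \matrix_(i < d.+1, j < d) C i j.
have A0 : kermx A != 0.
  rewrite kermx_eq0 /row_free; apply/negP => /eqP rA.
  by have := rank_leq_col A; rewrite rA ltnn.
pose c := nz_row (kermx A); have cA : c *m A = 0.
  by apply/sub_kermxP; exact: nz_row_sub.
exists (fun i => c 0 i).
  apply: contrapT => c0; move: A0; rewrite -nz_row_eq0 -/c => /eqP; apply.
  apply/rowP => i; rewrite mxE; apply/eqP; apply: contrapT => ci.
  by apply: c0; exists i; apply/negP.
have -> : \sum_i c 0 i *: v i = \sum_i c 0 i *: (v i - \sum_j C i j *: e j).
  under [RHS]eq_bigr => i _ do rewrite scalerBr scaler_sumr.
  rewrite big_split /= sumrN exchange_big /= -[LHS]subr0; congr (_ - _).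
  rewrite big1 // => j _; under eq_bigr => i _ do rewrite scalerA.
  rewrite -scaler_suml; have /matrixP/(_ 0 j) := cA.
  rewrite !mxE; under eq_bigr => i _ do rewrite mxE.
  by move=> ->; rewrite scale0r.
apply: big_ind => [||i _]; [exact: submodule0|exact: submoduleD|].
by apply: submoduleZ.
Qed.

Lemma span_seq (s : seq V) v : Defs.span [set x | x \in s]%classic v ->
  exists c : 'I_(size s) -> k, v = \sum_j c j *: s`_j.
Proof.
move=> [t ts ->]; exists (fun j : 'I_(size s) => \sum_(p <- t) (index p.2 s == j)%:R * p.1).
under [RHS]eq_bigr => j _ do rewrite scaler_suml.
rewrite exchange_big /=; apply: eq_big_seq => p /ts /= ps.
have ip : (index p.2 s < size s)%N by rewrite index_mem.
rewrite (bigD1 (Ordinal ip)) //= eqxx mul1r nth_index // big1 ?addr0 // => j.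
by rewrite -val_eqE /= eq_sym => /negPf ->; rewrite mul0r scale0r.
Qed.

Lemma span_lift (W : lmodType k) (phi : W -> V) (S : set W) (S' : set V) v :
  linear phi -> (forall y, S' y -> exists2 x, S x & phi x = y) ->
  Defs.span S' v -> exists2 x, Defs.span S x & phi x = v.
Proof.
move=> lphi lift [t ts ->]; elim: t ts => [|p t IHt] ts.
  exists 0; first exact: submodule0.
  by rewrite big_nil; have := lphi (-1) 0 0; rewrite scaler0 addr0 scaleN1r addNr.
have [x Sx xE] : exists2 x, Defs.span S x & phi x = \sum_(p <- t) p.1 *: p.2.
  by apply: IHt => q qt; apply: ts; rewrite inE qt orbT.
have [y Sy yE] := lift p.2 (ts p (mem_head _ _)).
exists (p.1 *: y + x); last by rewrite lphi big_cons yE xE.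
by apply: submoduleP => //; exact: Defs.sub_span.
Qed.

End Dependence.

Section FiniteDimension.
Variables (k : fieldType) (n : nat).
Local Notation F := (ncseries k n).
Local Notation C := (cyc0 k n).
Implicit Types (g : 'I_n -> F) (f h b : F) (u v w : seq 'I_n) (r : nat).
Implicit Types (i j : 'I_n) (U V : submodule F).

Lemma qclass0_Jac f h : qclass (jacobi_ideal (cproj f)) h = 0 <-> Jac f h.
Proof.
rewrite -[X in _ = X](raddf0 (qclass (jacobi_ideal (cproj f)))).
by rewrite qclass_eq subr0.
Qed.

(** The images of the powers of the maximal ideal decrease in a finite-dimensional
    quotient, so one of them equals the next. It then equals all later ones, and is zero
    because the ideal is closed. *)
Lemma mpow_Jac f : finite_dimensional (jacobi_algebra (cproj f)) ->
  exists N, forall h, mpow k n N h -> Jac f h.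
Proof.
case=> s sP; set Q := jacobi_ideal (cproj f) in s sP.
have step : exists r, forall h, mpow k n r h -> exists2 h', Jac f h' & mpow k n r.+1 (h - h').
  apply: contrapT => /forallNP noR.
  have {noR} /choice[y yP] : forall r, exists h, mpow k n r h /\
      ~ exists2 h', Jac f h' & mpow k n r.+1 (h - h').
    move=> r; have /existsNP[h /not_implyP[hr hN]] := noR r.
    by exists h.
  have := @linear_dependence k F (Jac f) (size s)
    (fun j : 'I_(size s) => generic_quotient.repr s`_j) (fun i : 'I_(size s).+1 => y i).
  case=> [r|c [i0 ci0] cJ].
    have [c cE] := span_seq (sP (qclass Q (y r))).
    exists c; apply/qclass0_Jac; rewrite raddfB /= cE raddf_sum /= -sumrB big1 // => j _.
    by rewrite qclassZ qclass_repr subrr.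
  have [i ci imin] := @arg_minnP _ _ (fun i : 'I_(size s).+1 => c i != 0) (fun i : 'I_(size s).+1 => val i) ci0.
  apply: (yP i).2; exists ((c i)^-1 *: \sum_l c l *: y l).
    exact: (@submoduleZ _ _ (Jac f)).
  rewrite (bigD1 i) //= scalerDr scalerA mulVf // scale1r opprD addrA subrr add0r.
  apply: (@submoduleN _ _ (mpow _ _ _)); apply: (@submoduleZ _ _ (mpow _ _ _)).
  apply: mpow_sum => l li; have [->|cl] := eqVneq (c l) 0.
    by rewrite scale0r; exact: (submodule0 (mpow _ _ _)).
  apply: (@submoduleZ _ _ (mpow _ _ _)); apply: mpow_le (yP l).1.
  by rewrite ltn_neqAle eq_sym li; exact: imin.
case: step => r stepr; exists r => h hr; apply: Jac_closed => m.
have stepm p : forall h, mpow k n (r + p) h ->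
    exists2 h', Jac f h' & mpow k n (r + p).+1 (h - h').
  elim: p => [|p IHp] h1; first by rewrite addn0; exact: stepr.
  rewrite addnS => h1r.
  have /choice[y yP] : forall i, exists h', Jac f h' /\ mpow k n (r + p).+1 (lquo i h1 - h').
    by move=> i; have [h' h'J h'r] := IHp _ (lquo_mpow i h1r); exists h'.
  exists (\sum_i var i * y i).
    apply: (@big_ind _ (Jac f)); first exact: (submodule0 (Jac f)).
      by move=> x z; exact: (@submoduleD _ _ (Jac f)).
    by move=> i _; apply: JacMl; exact: (yP i).1.
  rewrite {1}(mpow_expand h1r) -sumrB; apply: mpow_sum => i _.
  by rewrite -mulrBr -[(r + p).+2]add1n; apply: mpowM; [exact: var_mpow|exact: (yP i).2].
suff [g gJ gm] : exists2 g, Jac f g & mpow k n (r + m) (h - g).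
  by exists g => //; apply: mpow_le gm; lia.
elim: m => [|m [g gJ gm]].
  by exists 0; [exact: (submodule0 (Jac f))|rewrite subr0 addn0].
have [h' h'J h'm] := stepm _ _ gm; exists (g + h').
  exact: (@submoduleD _ _ (Jac f)).
by rewrite addnS opprD addrA.
Qed.

End FiniteDimension.

Section Successive.
Variables (k : fieldType) (n : nat).
Local Notation F := (ncseries k n).

(** Successive approximation: corrections of increasing order add up to a limit. The
    predicate [Q r] is to be thought of as being a solution up to order [r]; the limit
    agrees with some solution up to order [r], for each [r]. *)
Lemma successive (I : Type) (Q : nat -> (I -> F) -> Prop) r0 y0 :
  Q r0 y0 ->
  (forall r y, (r0 <= r)%N -> Q r y ->
     exists z, (forall i, mpow k n r (z i)) /\ Q r.+1 (fun i => y i + z i)) ->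
  exists y, (forall i, mpow k n r0 (y i - y0 i)) /\
    forall r, (r0 <= r)%N ->
      exists z, (forall i, mpow k n r (z i)) /\ Q r (fun i => y i + z i).
Proof.
move=> Q0 step.
have /choice[st stP] : forall p : nat * (I -> F), exists z, (r0 <= p.1)%N -> Q p.1 p.2 ->
    (forall i, mpow k n p.1 (z i)) /\ Q p.1.+1 (fun i => p.2 i + z i).
  move=> [r y] /=; have [[r0r Qy]|nQ] := pselect ((r0 <= r)%N /\ Q r y).
    by have [z zP] := step r y r0r Qy; exists z.
  by exists y => r0r Qy; case: nQ.
pose Y := fix Y m := if m is m'.+1 then fun i => Y m' i + st ((r0 + m')%N, Y m') i else y0.
have YQ m : Q (r0 + m)%N (Y m).
  elim: m => [|m IHm] /=; first by rewrite addn0.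
  by rewrite addnS; exact: (stP (r0 + m, Y m)%N (leq_addr _ _) IHm).2.
have Yd m p i : mpow k n (r0 + m) (Y (m + p)%N i - Y m i).
  elim: p => [|p IHp]; first by rewrite addn0 subrr; exact: (submodule0 (mpow _ _ _)).
  rewrite addnS /= addrAC; apply: (@submoduleD _ _ (mpow _ _ _)) => //.
  apply: mpow_le ((stP (r0 + (m + p), Y (m + p))%N (leq_addr _ _) (YQ _)).1 i).
  by rewrite /= addnA leq_addr.
(* After [(size w).+1] steps the coefficient of [w] no longer changes. *)
pose y i : F := fun w => Y (size w).+1 i w.
have yY m i : mpow k n (r0 + m) (y i - Y m i).
  move=> w wm; rewrite serD serN /y; have [mw|wm'] := leqP m (size w).
    by rewrite -(subnKC (leqW mw)) -serN -serD Yd.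
  have := Yd (size w).+1 (m - (size w).+1)%N i w; rewrite subnKC // serD serN.
  by move=> D; rewrite -[LHS]opprK opprB D ?oppr0 //; lia.
exists y; split=> [i|r r0r]; first by rewrite -[r0]addn0; exact: yY.
exists (fun i => Y (r - r0)%N i - y i); split=> [i|].
  rewrite -opprB; apply: (@submoduleN _ _ (mpow _ _ _)).
  by rewrite -{1}(subnKC r0r); exact: yY.
rewrite -{1}(subnKC r0r); have -> : (fun i => y i + (Y (r - r0)%N i - y i)) = Y (r - r0)%N.
  by apply/funext => i; rewrite addrC subrK.
exact: YQ.
Qed.

End Successive.

Section Euler.
Variables (k : fieldType) (n : nat).
Local Notation F := (ncseries k n).
Local Notation C := (cyc0 k n).
Implicit Types (g : 'I_n -> F) (f h b v : F) (u w : seq 'I_n) (r : nat).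
Implicit Types (i j : 'I_n) (U V : submodule F).

Lemma jacobi_projM (Phi : superpotential k n) (x y : F) :
  kmul (jacobi_proj Phi x) (jacobi_proj Phi y) = jacobi_proj Phi (x * y).
Proof. exact: quot_mulE. Qed.

Lemma jacobi_proj_linear (Phi : superpotential k n) : linear (jacobi_proj Phi).
Proof. exact: qclass_is_linear. Qed.

Lemma jacobi_proj_surj (Phi : superpotential k n) x : exists y, jacobi_proj Phi y = x.
Proof. by exists (generic_quotient.repr x); exact: qclass_repr. Qed.

Lemma ideal_pow_jacobi_lift (Phi : superpotential k n) r x :
  ideal_pow (@jacobi_max k n Phi) r x ->
  exists2 y, ideal_pow (A := free_alg k n) (@max_ideal k n) r y & jacobi_proj Phi y = x.
Proof.
elim: r x => [|r IHr] x; first by have [y yx] := jacobi_proj_surj x; exists y.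
apply: (@span_lift _ _ (free_alg k n) (jacobi_proj Phi)); first exact: jacobi_proj_linear.
move=> _ [a [b [[a' a'm <-] /IHr[b' b'm <-] ->]]].
by exists (a' * b'); [exists a', b'|rewrite -jacobi_projM].
Qed.

(** Once a power of the maximal ideal lies in the Jacobi ideal, the closure of the
    commutators in the Jacobi algebra adds nothing. *)
Lemma quasi_homogeneousP f N : (forall h, mpow k n N h -> Jac f h) ->
  quasi_homogeneous (cproj f) <-> exists2 c, C c & Jac f (f - c).
Proof.
move=> NJ; rewrite /quasi_homogeneous jacobi_classE; set P := jacobi_proj (cproj f).
have lP : linear P by exact: jacobi_proj_linear.
have q0 : cyc_proj (@jacobi_max k n (cproj f)) 0 = 0.
  exact: (raddf0 (qclass (adic_closure (@jacobi_max k n (cproj f))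
    (commutators (jacobi_algebra (cproj f)))))).
rewrite -q0; split=> [|[c cC fcJ]].
  move=> /qclass_eq; rewrite subr0 => /(_ N) [u [v [uc vN fE]]].
  have [v' v'N v'E] := ideal_pow_jacobi_lift vN.
  have [u' u'c u'E] : exists2 u', commutators (free_alg k n) u' & P u' = u.
    move: uc; apply: (@span_lift _ _ (free_alg k n) P) => // _ [a [b ->]].
    have [a' <-] := jacobi_proj_surj a; have [b' <-] := jacobi_proj_surj b.
    exists (a' * b' - b' * a'); first by exists a', b'.
    by rewrite !jacobi_projM; exact: raddfB.
  exists u'; first by move=> r; exists u', 0; split=> //; [exact: submodule0|rewrite addr0].
  rewrite -[f - u'](subrK v'); apply: (@submoduleD _ _ (Jac f)); last first.
    by apply: NJ; exact/ideal_powE.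
  apply/qclass0_Jac; rewrite !raddfB /=.
  have -> : qclass (jacobi_ideal (cproj f)) f = u + v by exact: fE.
  have -> : qclass (jacobi_ideal (cproj f)) u' = u by exact: u'E.
  have -> : qclass (jacobi_ideal (cproj f)) v' = v by exact: v'E.
  by rewrite addrAC addrK subrr.
apply/qclass_eq; rewrite subr0.
have -> : P f = P c.
  by apply/qclass_eq; exact: fcJ.
apply: (@adic_closure_commutators_morph _ (free_alg k n) (jacobi_algebra (cproj f))
  P _ _ (@max_ideal k n)) => //.
- by move=> x y; rewrite -[RHS]/(quot_mul _ _) quot_mulE.
- by move=> x mx; exists x.
Qed.

Lemma mpow_ind N r U : (forall w c, size w = N -> mpow k n r c -> U (monomial k w * c)) ->
  forall h, mpow k n (N + r) h -> U h.
Proof.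
elim: N U => [|N IHN] U UP h hN.
  by rewrite -[h]mul1r -monomial0; exact: UP.
rewrite (mpow_expand hN); apply: (@big_ind _ U).
- exact: (submodule0 U).
- by move=> x y; exact: (@submoduleD _ _ U).
move=> i _; have cm : ctn (fun h => var i * h) by repeat ctn_step.
apply: (IHN (preim cm.1 U)); last exact: lquo_mpow.
move=> w c wN cr; rewrite /= /preim_set mulrA -monomial_cons.
by apply: UP => //=; rewrite wN.
Qed.

(** The Jacobi ideal before taking the closure, up to order [N]. *)
Definition gradient_span f N : submodule F :=
  Defs.span [set h | (exists a b i, h = a * cycder i f * b) \/ mpow k n N h]%classic.

Lemma gradient_span_mpow f N h : mpow k n N h -> gradient_span f N h.
Proof. by move=> hN; apply: Defs.sub_span; right. Qed.

Lemma Jac_gradient_span f N h : Jac f h -> gradient_span f N h.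
Proof.
apply: Jac_min => [h'|a h'|a h'|i].
- move=> /(_ N)[x xs hx]; rewrite -[h'](subrK x).
  apply: (@submoduleD _ _ (gradient_span f N)) => //; exact: gradient_span_mpow.
- have cm : ctn (fun h => a * h) by repeat ctn_step.
  apply: (span_min (U := preim cm.1 (gradient_span f N))) => x xS.
  apply: Defs.sub_span; case: xS => [[c [b [i ->]]]|xN]; last by right; exact: mpowMl.
  by left; exists (a * c), b, i; rewrite !mulrA.
- have cm : ctn (fun h => h * a) by repeat ctn_step.
  apply: (span_min (U := preim cm.1 (gradient_span f N))) => x xS.
  apply: Defs.sub_span; case: xS => [[c [b [i ->]]]|xN]; last by right; exact: mpowMr.
  by left; exists c, (b * a), i; rewrite !mulrA.
by apply: Defs.sub_span; left; exists 1, 1, i; rewrite mul1r mulr1.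
Qed.

(** Combinations of the cyclic derivatives with coefficients of order [r], up to
    commutators and terms of order [M]. *)
Definition approx_set f r M h :=
  exists g v, [/\ forall i, mpow k n r (g i), mpow k n M v &
    C (h - \sum_i g i * cycder i f - v)].

Lemma approx_set0 f r M : approx_set f r M 0.
Proof.
exists (fun=> 0), 0; split; [move=> i|..]; try exact: (submodule0 (mpow _ _ _)).
rewrite big1 ?subr0; first exact: (submodule0 C).
by move=> i _; rewrite mul0r.
Qed.

Lemma approx_setP f r M a h h' :
  approx_set f r M h -> approx_set f r M h' -> approx_set f r M (a *: h + h').
Proof.
move=> [g [v [gr vM hC]]] [g' [v' [gr' vM' hC']]].
exists (fun i => a *: g i + g' i), (a *: v + v'); split.
- by move=> i; exact: (@submoduleP _ _ (mpow _ _ _)).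
- exact: (@submoduleP _ _ (mpow _ _ _)).
have := @submoduleP _ _ C a _ _ hC hC'; congr (C _).
rewrite !scalerBr scaler_sumr.
under [in RHS]eq_bigr => i _ do rewrite mulrDl -scalerAl.
by rewrite big_split; apply/funext => u; rewrite /= !(serD, serN); ring.
Qed.

Definition approx f r M : submodule F :=
  Submodule (approx_set0 f r M) (@approx_setP f r M).

(** Up to commutators, [a * cycder i f * b * c] is [b * c * a * cycder i f]. *)
Lemma gradient_span_approx f N r h c :
  gradient_span f N h -> mpow k n r c -> approx f r (N + r) (h * c).
Proof.
move=> hs cr; have cm : ctn (fun h => h * c) by repeat ctn_step.
move: h hs; apply: (span_min (U := preim cm.1 (approx f r (N + r)))) => h.
case=> [[a [b [i ->]]]|hN].
  exists (fun l => if l == i then b * c * a else 0), 0; split.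
  - move=> l; case: eqP => _; last exact: (submodule0 (mpow _ _ _)).
    by apply: mpowMr; exact: mpowMl.
  - exact: (submodule0 (mpow _ _ _)).
  rewrite (bigD1 i) //= eqxx big1 ?addr0 ?subr0; last first.
    by move=> l /negPf ->; rewrite mul0r.
  have -> : a * cycder i f * b * c - b * c * a * cycder i f =
    (a * cycder i f) * (b * c) - (b * c) * (a * cycder i f) by rewrite !mulrA.
  exact: cyc0_comm.
exists (fun=> 0), (h * c); split.
- by move=> l; exact: (submodule0 (mpow _ _ _)).
- exact: mpowM.
rewrite big1 ?subr0 ?subrr; first exact: (submodule0 C).
by move=> l _; rewrite mul0r.
Qed.

(** Each step of the approximation removes a remainder [v] of order [N + r]: its initial
    words of length [N] lie in the Jacobi ideal, and the rest of [v] supplies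
    coefficients of order [r]. So the coefficients [g i] converge. *)
Lemma euler_exists f N : (forall h, mpow k n N h -> Jac f h) ->
  quasi_homogeneous (cproj f) -> exists g, C (der g f - f).
Proof.
move=> NJ /(quasi_homogeneousP NJ)[c cC fcJ].
pose Q r g := exists2 v : F, mpow k n (N + r) v & C (f - \sum_i g i * cycder i f - v).
have [g0 [v0 [_ v0N g0C]]] : approx f 0 (N.+1 + 0) ((f - c) * 1).
  by apply: gradient_span_approx => //; exact: Jac_gradient_span.
have Q0 : Q 0%N g0.
  exists v0; first by apply: mpow_le v0N; lia.
  have := @submoduleD _ _ C _ _ g0C cC; congr (C _).
  by rewrite mulr1; apply/funext => u; rewrite !(serD, serN); ring.
case: (successive Q0) => [r g _ [v vN gC]|g [_ gP]].
  have [z [v' [zr v'N zC]]] : approx f r (N.+1 + r) v.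
    apply: (@mpow_ind N r) vN => w d wN dr; apply: gradient_span_approx => //.
    by apply: Jac_gradient_span; apply: NJ; apply: mpow_monomial; rewrite wN.
  exists z; split=> //; exists v'; first by rewrite addnS.
  have := @submoduleD _ _ C _ _ gC zC; congr (C _).
  under [in RHS]eq_bigr => i _ do rewrite mulrDl.
  by rewrite big_split; apply/funext => u; rewrite /= !(serD, serN); ring.
exists g; rewrite -opprB; apply: (@submoduleN _ _ C).
have -> : f - der g f = (f - \sum_i g i * cycder i f) - (der g f - \sum_i g i * cycder i f).
  by rewrite opprB addrA subrK.
apply: (@submoduleB _ _ C); last exact: der_cycder.
apply: cyc0_closed => r; have [z [zr [v vN zC]]] := gP r isT.
exists (f - \sum_i (g i + z i) * cycder i f - v) => //.
set x := \sum_i (_ + _) * _; have -> : x = \sum_i g i * cycder i f + \sum_i z i * cycder i f.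
  by rewrite -big_split; apply: eq_bigr => i _; rewrite mulrDl.
rewrite (_ : _ - _ = v + \sum_i z i * cycder i f).
  apply: (@submoduleD _ _ (mpow _ _ _)); first by apply: mpow_le vN; lia.
  by apply: mpow_sum => i _; exact: mpowMr.
by apply/funext => u; rewrite !(serD, serN); ring.
Qed.

(** The sum in [der_cycder] lies in the Jacobi ideal. *)
Lemma euler_quasi_homogeneous f g N : (forall h, mpow k n N h -> Jac f h) ->
  C (der g f - f) -> quasi_homogeneous (cproj f).
Proof.
move=> NJ gf; apply/(quasi_homogeneousP NJ).
exists (f - \sum_i g i * cycder i f).
  have := @submoduleB _ _ C _ _ (der_cycder g f) gf; congr (C _).
  by apply/funext => u; rewrite !(serD, serN); ring.
rewrite subKr; apply: (@big_ind _ (Jac f)); first exact: (submodule0 (Jac f)).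
  by move=> x y; exact: (@submoduleD _ _ (Jac f)).
by move=> i _; apply: JacMl; exact: Jac_cycder.
Qed.

Lemma Jac_mpow f r : mpow k n r.+1 f -> forall h, Jac f h -> mpow k n r h.
Proof.
move=> fr; apply: Jac_min; first exact: mpow_closed.
- by move=> a h; exact: mpowMl.
- by move=> a h; exact: mpowMr.
by move=> i; exact: cycder_mpow.
Qed.

Lemma der_varX g i (j : nat) :
  mpow k n j.+1 (der g (var i ^+ j.+1) - ((g i [::]) *+ j.+1) *: var i ^+ j).
Proof.
have vX l : mpow k n l (var i ^+ l : F).
  by elim: l => [//|l IHl]; rewrite exprS -add1n; apply: mpowM => //; exact: var_mpow.
have gi l : mpow k n l.+1 (g i * var i ^+ l - g i [::] *: var i ^+ l).
  rewrite -[g i [::] *: _]mul1r -scalerAr scalerAl -mulrBl -add1n; apply: mpowM => //.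
  by apply/mpow1; rewrite serD serN serZ ser1E mulr1 subrr.
elim: j => [|j IHj].
  by rewrite expr1 der_var; have := gi 0%N; rewrite expr0 mulr1.
rewrite exprS derM der_var mulrS scalerDl opprD addrACA.
apply: (@submoduleD _ _ (mpow _ _ _)) => //.
rewrite [in X in _ - X]exprS scalerAr -mulrBr -[j.+2]add1n.
by apply: mpowM => //; exact: var_mpow.
Qed.

(** A derivation with non-zero constant terms cannot preserve a proper ideal of finite
    codimension in characteristic zero: applied [N] times to the [N]-th power of a
    variable it leaves [N`!] times a power of that constant. *)
Lemma euler_mpow1 (hk : [pchar k] =i pred0) f g N :
  (forall h, mpow k n N h -> Jac f h) -> mpow k n 2 f -> C (der g f - f) ->
  forall i, mpow k n 1 (g i).
Proof.
move=> NJ f2 gf i; apply/mpow1.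
have lin := (der_ctn g).1.
have itS (j : nat) h : mpow k n j.+1 h -> iter j (der g) h [::] = 0.
  elim: j h => [|j IHj] h hj; first exact: hj.
  by rewrite iterSr; apply: IHj; exact: der_mpowS.
have itD (j : nat) a h h' : iter j (der g) (a *: h + h') = a *: iter j (der g) h + iter j (der g) h'.
  by elim: j => [//|j IHj]; rewrite !iterS IHj lin.
have itX (j : nat) : iter j (der g) (var i ^+ j) [::] = j`!%:R * (g i [::]) ^+ j.
  elim: j => [|j IHj]; first by rewrite /= expr0 ser1E mulr1.
  rewrite iterSr; have := itS j _ (@der_varX g i j).
  set c := g i [::] in IHj *; set x := der g _ => D.
  have -> : x = (c *+ j.+1) *: var i ^+ j + (x - (c *+ j.+1) *: var i ^+ j).
    by rewrite addrC subrK.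
  rewrite itD serD D addr0 serZ IHj factS natrM exprS -mulr_natr.
  by rewrite !mulrA; congr (_ * _); ring.
have : iter N (der g) (var i ^+ N) [::] = 0.
  have JX : Jac f (var i ^+ N).
    apply: NJ; elim: (N) => [//|l IHl]; rewrite exprS -add1n; apply: mpowM => //.
    exact: var_mpow.
  apply: (@Jac_mpow f 1 f2 _ _ [::]) => //.
  by elim: (N) (var i ^+ N) JX => [//|j IHj] h hJ; rewrite iterSr; apply: IHj; exact: der_Jac.
rewrite itX => /eqP; rewrite mulf_eq0 expf_eq0.
have /pcharf0P -> := hk; rewrite -leqn0 leqNgt fact_gt0 /= => /andP[_ /eqP] //.
Qed.

End Euler.

(** * Polynomials in a derivation *)

Section PolynomialAction.
Variables (k : fieldType) (V : lmodType k) (d : V -> V).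
Hypothesis d_lin : linear d.
Implicit Types (p q : {poly k}) (f : V).

(** The value at [f] of the polynomial [p] in the operator [d]. *)
Definition pact p f : V := \sum_(i < size p) p`_i *: iter i d f.

Lemma pact_widen N p f : (size p <= N)%N -> pact p f = \sum_(i < N) p`_i *: iter i d f.
Proof.
move=> pN; rewrite /pact (big_ord_widen N (fun i => p`_i *: iter i d f)) // big_mkcond /=.
apply: eq_bigr => i _; case: ltnP => // ip.
by rewrite nth_default // scale0r.
Qed.

Lemma pactP a p q f : pact (a *: p + q) f = a *: pact p f + pact q f.
Proof.
pose N := maxn (size p) (size q).
rewrite (@pact_widen N p) ?leq_maxl // (@pact_widen N q) ?leq_maxr //.
rewrite (@pact_widen N); last first.
  rewrite (leq_trans (size_polyD _ _)) // geq_max leq_maxr andbT.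
  by rewrite (leq_trans (size_scale_leq _ _)) // leq_maxl.
rewrite scaler_sumr -big_split; apply: eq_bigr => i _.
by rewrite coefD coefZ scalerDl scalerA.
Qed.

Lemma pactD p q f : pact (p + q) f = pact p f + pact q f.
Proof. by rewrite -{1}[p]scale1r pactP scale1r. Qed.

Lemma pact0 f : pact 0 f = 0.
Proof. by rewrite /pact size_poly0 big_ord0. Qed.

Lemma pactZ a p f : pact (a *: p) f = a *: pact p f.
Proof. by rewrite -[a *: p]addr0 pactP pact0 addr0. Qed.

Lemma pact1 f : pact 1 f = f.
Proof. by rewrite /pact size_poly1 big_ord1 coef1 scale1r. Qed.

Lemma iter_linear i : linear (iter i d).
Proof. by elim: i => [//|i IHi] a f h; rewrite !iterS IHi d_lin. Qed.

Lemma pact_linear p : linear (pact p).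
Proof.
move=> a f h; rewrite /pact scaler_sumr -big_split; apply: eq_bigr => i _.
by rewrite iter_linear scalerDr !scalerA mulrC.
Qed.

Lemma pactXM p f : pact ('X * p) f = d (pact p f).
Proof.
rewrite (@pact_widen (size p).+1); last first.
  by rewrite -commr_polyX; apply: leq_trans (size_polyMleq _ _) _; rewrite size_polyX addn2.
rewrite big_ord_recl coefXM scale0r add0r.
have d0 : d 0 = 0 by have := d_lin (-1) 0 0; rewrite scaler0 addr0 scaleN1r addNr.
have dD x y : d (x + y) = d x + d y by have := d_lin 1 x y; rewrite !scale1r.
rewrite /pact (big_morph d dD d0); apply: eq_bigr => i _.
by rewrite coefXM /= -[p`_i *: _ in RHS]addr0 d_lin d0 addr0.
Qed.

Lemma pactM p q f : pact (p * q) f = pact p (pact q f).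
Proof.
elim/poly_ind: p => [|p c IHp]; first by rewrite mul0r !pact0.
have -> : (p * 'X + c%:P) * q = 'X * (p * q) + c *: q.
  by rewrite mulrDl mul_polyC commr_polyX mulrA.
rewrite pactD pactXM pactZ IHp commr_polyX pactD pactXM; congr (_ + _).
by rewrite -alg_polyC pactZ pact1.
Qed.

Lemma pactC p q f : pact p (pact q f) = pact q (pact p f).
Proof. by rewrite -!pactM mulrC. Qed.

Lemma pact_XsubC a f : pact ('X - a%:P) f = d f - a *: f.
Proof.
rewrite -['X]mulr1 pactD pactXM pact1; congr (_ + _).
by rewrite -alg_polyC -scaleNr pactZ pact1 scaleNr.
Qed.

Lemma pact_exp_recr a N f :
  pact (('X - a%:P) ^+ N.+1) f = pact (('X - a%:P) ^+ N) (d f - a *: f).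
Proof. by rewrite exprSr pactM pact_XsubC. Qed.

Lemma pact_mono a M N f (U : submodule V) : (forall f, U f -> U (d f)) ->
  (M <= N)%N -> U (pact (('X - a%:P) ^+ M) f) -> U (pact (('X - a%:P) ^+ N) f).
Proof.
move=> dU /subnK <-; rewrite exprD pactM => Uf; elim: (N - M)%N => [|m IHm].
  by rewrite expr0 pact1.
rewrite exprS pactM pact_XsubC; apply: submoduleB; first exact: dU.
exact: submoduleZ.
Qed.

Lemma pact_stable p f (U : submodule V) : (forall f, U f -> U (d f)) -> U f -> U (pact p f).
Proof.
move=> dU Uf; apply: big_ind; [exact: submodule0|exact: submoduleD|move=> i _].
by apply: submoduleZ; elim: (i : nat) => [//|m IHm] /=; exact: dU.
Qed.

Lemma pact_eigen p f (U : submodule V) c : (forall f, U f -> U (d f)) ->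
  U (d f - c *: f) -> U (pact p f - p.[c] *: f).
Proof.
move=> dU fU; elim/poly_ind: p => [|p a IHp].
  by rewrite pact0 horner0 scale0r subr0; exact: submodule0.
rewrite commr_polyX pactD pactXM hornerD hornerM hornerX hornerC.
rewrite -[a%:P]alg_polyC pactZ pact1 scalerDl opprD addrACA subrr addr0.
have dB x y : d (x - y) = d x - d y by rewrite addrC -scaleN1r d_lin scaleN1r addrC.
have dZ b x : d (b *: x) = b *: d x.
  have d0 : d 0 = 0 by have := d_lin (-1) 0 0; rewrite scaler0 addr0 scaleN1r addNr.
  by rewrite -[b *: x]addr0 d_lin d0 addr0.
have -> : d (pact p f) - (c * p.[c]) *: f =
   d (pact p f - p.[c] *: f) + p.[c] *: (d f - c *: f).
  by rewrite dB dZ scalerBr scalerA addrA subrK mulrC.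
by apply: submoduleD; [exact: dU|exact: submoduleZ].
Qed.

End PolynomialAction.

Lemma split_root (k : closedFieldType) (p : {poly k}) a : p != 0 ->
  exists m q u v, [/\ p = q * ('X - a%:P) ^+ m, ~~ root q a &
    u * q + v * ('X - a%:P) ^+ m = 1].
Proof.
move=> p0; have [m [q]] := multiplicity_XsubC p a; rewrite p0 /= => qa pE.
have /Bezout_eq1_coprimepP[[u v] /= uv1] : coprimep q (('X - a%:P) ^+ m).
  by apply: coprimep_expr; rewrite coprimep_XsubC.
by exists m, q, u, v.
Qed.

(** Primary decomposition of a vector killed by a polynomial modulo [U], one root at a
    time. The components stay in every [d]-stable subspace [W], being polynomials in
    [d] applied to [f]. *)
Lemma eigen_decomposition (k : closedFieldType) (V : lmodType k) (d : V -> V)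
    (U W : submodule V) (p : {poly k}) f :
  linear d -> (forall f, U f -> U (d f)) -> (forall f, W f -> W (d f)) ->
  p != 0 -> U (pact d p f) -> W f ->
  exists2 s : seq (k * V), f = \sum_(x <- s) x.2 &
    forall x, x \in s -> W x.2 /\ exists N, U (pact d (('X - x.1%:P) ^+ N) x.2).
Proof.
move=> lind dU dW; have [m] := ubnP (size p).
elim: m p f => [//|m IHm] p f pm p0 pU Wf.
have [/size_poly1P[c c0 pE]|] := boolP (size p == 1%N).
  exists [:: (0, f)]; first by rewrite big_seq1.
  move=> x; rewrite inE => /eqP -> /=; split=> //; exists 0%N; rewrite expr0 pact1.
  move: pU; rewrite pE -alg_polyC pactZ pact1 => /(submoduleZ c^-1).
  by rewrite scalerA mulVf // scale1r.
move=> /closed_rootP[a pa].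
have [l [q [u [v [pE qa uv]]]]] := split_root a p0.
have q0 : q != 0 by apply: contraNneq p0 => q0; rewrite pE q0 mul0r.
have l0 : (0 < l)%N.
  by case: l pE {uv} => // pE; move: pa; rewrite pE expr0 mulr1 (negPf qa).
pose r := ('X - a%:P) ^+ l.
have sp : (size q < m)%N.
  move: pm; rewrite pE size_Mmonic ?monic_exp ?monicXsubC //.
  rewrite size_exp_XsubC addnS /= ltnS; apply: leq_trans.
  by rewrite -addn1 leq_add2l.
have fE : f = pact d (u * q) f + pact d (v * r) f by rewrite -pactD uv pact1.
case: (IHm q (pact d (v * r) f) sp q0) => [||s sE sP].
- have -> : pact d q (pact d (v * r) f) = pact d v (pact d p f).
    by rewrite -!pactM // pE; congr (pact _ _ _); rewrite -/r; ring.
  exact: pact_stable.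
- exact: pact_stable.
exists ((a, pact d (u * q) f) :: s); first by rewrite big_cons -sE.
move=> x; rewrite inE => /orP[/eqP -> /=|/sP//]; split; first exact: pact_stable.
exists l; have -> : pact d (('X - a%:P) ^+ l) (pact d (u * q) f) = pact d u (pact d p f).
  by rewrite -!pactM // pE; congr (pact _ _ _); ring.
exact: pact_stable.
Qed.

(** * Coordinates of generalized eigenvectors *)

Section Automorphisms.
Variables (k : fieldType) (n : nat).
Local Notation F := (ncseries k n).
Implicit Types (f h : F) (w : seq 'I_n) (i j : 'I_n).

(** The linear part, which represents the class modulo [mpow 2] of a series without
    constant term. *)
Definition lin f : 'rV[k]_n := \row_j f [:: j].

Lemma lin_linear a f h : lin (a *: f + h) = a *: lin f + lin h.
Proof. by apply/rowP => j; rewrite !mxE serD serZ. Qed.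

Lemma lin_sum (I : Type) (s : seq I) (P : pred I) (c : I -> k) (G : I -> F) :
  lin (\sum_(i <- s | P i) c i *: G i) = \sum_(i <- s | P i) c i *: lin (G i).
Proof.
elim: s => [|i s IHs]; first by rewrite !big_nil; apply/rowP => j; rewrite !mxE.
by rewrite !big_cons; case: ifP => // _; rewrite lin_linear IHs.
Qed.

Lemma lin_var i : lin (var i) = delta_mx 0 i.
Proof. by apply/rowP => j; rewrite !mxE /var /monomial eqseq_cons andbT. Qed.

Lemma mpow2 f : mpow k n 2 f <-> f [::] = 0 /\ lin f = 0.
Proof.
split=> [f2|[f0 f1] [//|i [|//]] _].
  by split; [exact: f2|apply/rowP => j; rewrite !mxE; exact: f2].
by have /rowP/(_ i) := f1; rewrite !mxE.
Qed.

Lemma mpow2_lin f h : mpow k n 2 (f - h) -> lin f = lin h.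
Proof.
move=> fh; apply/rowP => j; rewrite !mxE.
by apply/eqP; rewrite -subr_eq0 -serN -serD fh.
Qed.

Lemma lrm_ext (s t : {lrmorphism F -> F}) :
  (forall i, s (var i) = t (var i)) -> forall f, s f = t f.
Proof.
move=> st; apply: ctn_eq; try exact: lrm_ctn.
elim=> [|i w IHw]; first by rewrite monomial0 !rmorph1.
by rewrite monomial_cons !rmorphM /= IHw st.
Qed.

Lemma lrm_inverse (s : {lrmorphism F -> F}) : bijective s ->
  exists t : {lrmorphism F -> F}, cancel s t /\ cancel t s.
Proof.
case=> t0 sK tK.
have lin_t : linear t0.
  by move=> a f h; apply: (can_inj sK); rewrite tK (lrm_ctn s).1 !tK.
have t1 : t0 1 = 1 by rewrite -{1}(rmorph1 s) sK.
have tM : {morph t0 : f h / f * h}.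
  by move=> f h; apply: (can_inj sK); rewrite tK rmorphM /= !tK.
pose L := GRing.isLinear.Build k F F *:%R t0 lin_t.
pose M := GRing.isMonoidMorphism.Build F F t0 (t1, tM).
pose t : {lrmorphism F -> F} := HB.pack t0 L M.
by exists t.
Qed.

(** A substitution that is the identity to first order is invertible, because it
    differs from the identity by a map that increases the order. *)
Lemma lrm_unipotent_bij (s : {lrmorphism F -> F}) :
  (forall i, mpow k n 2 (s (var i) - var i)) -> bijective s.
Proof.
move=> s2; have sN r f : mpow k n r f -> mpow k n r.+1 (s f - f).
  elim: r f => [|r IHr] f fr.
    have sl := (lrm_ctn s).1.
    apply/mpow1; rewrite {1}[f]lquoE (linear_mapD _ _ sl) (linear_mapZ _ _ sl).
    rewrite rmorph1 raddf_sum /=.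
    rewrite serD serN serD serZ ser1E eqxx mulr1 ser_sumE big1 ?addr0 ?subrr // => i _.
    rewrite rmorphM /= serM_const; have /mpow1 -> : mpow k n 1 (s (var i)).
      by apply: lrm_mpow; exact: var_mpow.
    by rewrite mul0r.
  rewrite (mpow_expand fr) raddf_sum -sumrB; apply: mpow_sum => i _ /=; rewrite rmorphM.
  have fir := lquo_mpow i fr; set a := var i; set b := lquo i f.
  have -> : s a * s b - a * b = (s a - a) * s b + a * (s b - b).
    by rewrite mulrBl mulrBr addrA subrK.
  apply: (@submoduleD _ _ (mpow _ _ _)).
    by rewrite -[r.+2]/(2 + r)%N; apply: mpowM; [exact: s2|exact: lrm_mpow].
  by rewrite -[r.+2]add1n; apply: mpowM; [exact: var_mpow|exact: IHr].
have s_inj : injective s.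
  move=> f h fh; apply/eqP; rewrite -subr_eq0; apply/eqP; apply: mpow_inf.
  elim=> [//|r IHr]; have := sN _ _ IHr; rewrite raddfB /= fh subrr sub0r.
  by move/(@submoduleN _ _ (mpow _ _ _)); rewrite opprK.
have /choice[t tK] : forall f, exists h, s h = f.
  move=> f; pose Q r (y : unit -> F) := mpow k n r (f - s (y tt)).
  have Q0 : Q 0%N (fun=> 0) by [].
  case: (successive Q0) => [r y _ Qy|y [_ yP]].
    exists (fun=> f - s (y tt)); split=> //; rewrite /Q raddfD /=.
    rewrite opprD addrA -opprB; apply: (@submoduleN _ _ (mpow _ _ _)); exact: sN.
  exists (y tt); apply/eqP; rewrite eq_sym -subr_eq0; apply/eqP; apply: mpow_inf => r.
  have [z [zr]] := yP r isT; rewrite /Q raddfD /= opprD addrA => D.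
  rewrite -[f - s (y tt)](subrK (s (z tt))).
  by apply: (@submoduleD _ _ (mpow _ _ _)) => //; exact: lrm_mpow.
by exists t => // f; apply: s_inj; rewrite tK.
Qed.

(** The inverse function theorem for formal substitutions: after a linear substitution
    the linear part becomes the identity. *)
Lemma subst_bij (y : 'I_n -> F) : (forall i, mpow k n 1 (y i)) ->
  \matrix_i lin (y i) \in unitmx ->
  exists2 s : {lrmorphism F -> F}, bijective s & forall i, s (var i) = y i.
Proof.
move=> y1; set P := \matrix_i _ => Pu; pose B := invmx P.
have lin_subst (A : 'M[k]_n) (x : 'I_n -> F) : (forall i, mpow k n 1 (x i)) ->
    forall i, mpow k n 1 (\sum_j A i j *: x j).
  by move=> x1 i; apply: mpow_sum => j _; exact: (@submoduleZ _ _ (mpow _ _ _)).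
have lin_sum2 (A A' : 'M[k]_n) (x : 'I_n -> F) i :
    \sum_j A i j *: (\sum_l A' j l *: x l) = \sum_l (A *m A') i l *: x l.
  under eq_bigr => j _ do rewrite scaler_sumr.
  rewrite exchange_big /=; apply: eq_bigr => l _.
  rewrite mxE scaler_suml; apply: eq_bigr => j _; exact: scalerA.
have sum1 (x : 'I_n -> F) i : \sum_l (1%:M : 'M[k]_n) i l *: x l = x i.
  rewrite (bigD1 i) //= big1 ?addr0 => [|l /negPf li]; first by rewrite mxE eqxx scale1r.
  by rewrite mxE eq_sym li scale0r.
have v1 i : mpow k n 1 (var i) by exact: var_mpow.
have [s1 s1E] := subst_exists (lin_subst B y y1).
have [t tE] := subst_exists (lin_subst P var v1).
have [t' t'E] := subst_exists (lin_subst B var v1).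
have comp_var (a b : {lrmorphism F -> F}) (A : 'M[k]_n) (x : 'I_n -> F) i :
    b (var i) = \sum_j A i j *: x j -> a (b (var i)) = \sum_j A i j *: a (x j).
  move=> ->; rewrite raddf_sum; apply: eq_bigr => j _ /=.
  exact: (linear_mapZ _ _ (lrm_ctn a).1).
have tt' f : t (t' f) = f.
  move: f; apply: (@lrm_ext (t \o t') idfun) => i /=.
  rewrite (comp_var _ _ B var i (t'E i)); under eq_bigr => j _ do rewrite tE.
  by rewrite lin_sum2 mulVmx // sum1.
have t't f : t' (t f) = f.
  move: f; apply: (@lrm_ext (t' \o t) idfun) => i /=.
  rewrite (comp_var _ _ P var i (tE i)); under eq_bigr => j _ do rewrite t'E.
  by rewrite lin_sum2 mulmxV // sum1.
have bs1 : bijective s1.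
  apply: lrm_unipotent_bij => i; rewrite s1E; apply/mpow2; split.
    rewrite serD serN ser_sumE big1 => [|j _]; last by rewrite serZ y1 // mulr0.
    by rewrite /var /monomial subr0.
  rewrite addrC -scaleN1r lin_linear lin_sum lin_var scaleN1r.
  have -> : \sum_j B i j *: lin (y j) = row i (B *m P).
    by rewrite row_mul mulmx_sum_row; apply: eq_bigr => j _; rewrite mxE rowK.
  by rewrite mulVmx // rowE mulmx1 addNr.
exists (s1 \o t)%FUN; first by apply: bij_comp => //; exists t'.
move=> i /=; rewrite (comp_var _ _ P var i (tE i)); under eq_bigr => j _ do rewrite s1E.
by rewrite lin_sum2 mulmxV // sum1.
Qed.

End Automorphisms.

(** * Generalized eigenvectors of a derivation *)

Section NormalForm.
Variables (k : closedFieldType) (n : nat).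
Local Notation F := (ncseries k n).
Local Notation C := (cyc0 k n).
Implicit Types (f h : F) (w : seq 'I_n) (i j : 'I_n) (a b : k).
Variables (g : 'I_n -> F).
Hypothesis g1 : forall i, mpow k n 1 (g i).
Local Notation d := (der g).
Local Notation act := (pact (der g)).

Let d_lin : linear d. Proof. exact: (der_ctn g).1. Qed.

Let d_mpow r f : mpow k n r f -> mpow k n r (d f).
Proof. exact: der_mpow. Qed.

Let act_lin p : linear (act p). Proof. exact: pact_linear. Qed.

Let act_mpow p r f : mpow k n r f -> mpow k n r (act p f).
Proof. by move=> fr; apply: (@pact_stable _ _ d p f (mpow k n r)) => // h; exact: d_mpow. Qed.

(** The iterates of [f] are dependent modulo [mpow r], which has finite codimension. *)
Lemma pact_word_annihilator r f : exists2 p : {poly k}, p != 0 & mpow k n r (act p f).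
Proof.
pose W := words n r.
have [i|c [i0 ci0] cr] := @linear_dependence k F (mpow k n r) (size W)
  (fun j : 'I_(size W) => monomial k (nth [::] W j)) (fun i : 'I_(size W).+1 => iter i d f).
  exists (fun j : 'I_(size W) => iter i d f (nth [::] W j)).
  have := @truncation_mpow k n r (iter i d f).
  by rewrite /truncation (big_nth [::]) big_mkord.
exists (\poly_(i < (size W).+1) c (inord i)).
  apply: contraNneq ci0 => /(congr1 (fun p : {poly k} => p`_i0)).
  by rewrite coef_poly coef0 ltn_ord inord_val => ->.
rewrite (@pact_widen _ _ _ (size W).+1) ?size_poly //.
by under eq_bigr => i _ do rewrite coef_poly ltn_ord inord_val.
Qed.

Lemma pact_annihilator r : exists2 p : {poly k}, p != 0 & forall f, mpow k n r (act p f).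
Proof.
have /choice[p pP] : forall w, exists p : {poly k}, p != 0 /\ mpow k n r (act p (monomial k w)).
  by move=> w; have [p p0 pw] := pact_word_annihilator r (monomial k w); exists p.
exists (\prod_(w <- words n r) p w).
  by rewrite prodf_seq_neq0; apply/allP => w _; exact: (pP w).1.
move=> f; rewrite -[f](subrK (truncation r f)).
rewrite (linear_mapD _ _ (act_lin _)); apply: (@submoduleD _ _ (mpow k n r)).
  by apply: act_mpow; exact: truncation_mpow.
rewrite /truncation (linear_map_sum _ _ _ (act_lin _)) big_seq.
apply: mpow_sum => w wr; rewrite (linear_mapZ _ _ (act_lin _)).
apply: (@submoduleZ _ _ (mpow k n r)).
rewrite (big_rem w) //= mulrC pactM //; apply: act_mpow; exact: (pP w).2.
Qed.

(** Generalized eigenvectors modulo [mpow r] for the eigenvalue [a]. *)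
Definition geigen a r f := exists N, mpow k n r (act (('X - a%:P) ^+ N) f).

Lemma geigen_mpow a r f : mpow k n r f -> geigen a r f.
Proof. by exists 0%N; rewrite expr0 pact1. Qed.

Lemma geigen_le a r f N M : (N <= M)%N ->
  mpow k n r (act (('X - a%:P) ^+ N) f) -> mpow k n r (act (('X - a%:P) ^+ M) f).
Proof. by apply: (@pact_mono _ _ d d_lin a N M f (mpow k n r)) => h; exact: d_mpow. Qed.

Lemma geigenD a r f h : geigen a r f -> geigen a r h -> geigen a r (f + h).
Proof.
move=> [N fN] [M hM]; exists (maxn N M); rewrite (linear_mapD _ _ (act_lin _)).
apply: (@submoduleD _ _ (mpow k n r)).
  exact: geigen_le (leq_maxl _ _) fN.
exact: geigen_le (leq_maxr _ _) hM.
Qed.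

(** Weights add up under multiplication, by the Leibniz rule. *)
Lemma geigenM a b r f h : geigen a r f -> geigen b r h -> geigen (a + b) r (f * h).
Proof.
move=> [N fN] [M hM]; exists (N + M)%N.
move: {2}(N + M)%N (leqnn (N + M)) => m; elim: m N M f h fN hM => [|m IHm] N M f h.
  rewrite leqn0 addn_eq0 => fN hM /andP[/eqP N0 /eqP M0].
  move: fN hM; rewrite N0 M0 addn0 !expr0 !pact1 => fN hM; exact: mpowMr.
case: N => [|N].
  by rewrite expr0 pact1 => fr _ _; apply: act_mpow; exact: mpowMr.
case: M => [|M].
  by rewrite expr0 pact1 => _ hr _; apply: act_mpow; exact: mpowMl.
move=> fN hM NM; rewrite addSn pact_exp_recr // derM.
have -> : d f * h + f * d h - (a + b) *: (f * h) =
    (d f - a *: f) * h + f * (d h - b *: h).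
  rewrite mulrBl mulrBr -scalerAl -scalerAr scalerDl.
  by apply/funext => u; rewrite !(serD, serN); ring.
rewrite (linear_mapD _ _ (act_lin _)); apply: (@submoduleD _ _ (mpow k n r)).
  by apply: IHm => //; rewrite -pact_exp_recr.
have -> : (N + M.+1 = N.+1 + M)%N by rewrite addnS.
apply: IHm => //; last by rewrite addSnnS.
by rewrite -pact_exp_recr.
Qed.

(** Let [h := ('X - a) ^+ N] applied to [f], of order [r]. Some polynomial
    [q * ('X - a) ^+ m] with [q] prime to ['X - a] raises the order to [r.+1], and
    Bezout for [q] and [('X - a) ^+ N] splits [h] into a part that is killed modulo
    [mpow r.+1] by [('X - a) ^+ m] and a part that is removed by the correction [z]. *)
Lemma geigen_lift a r f : mpow k n 1 f -> geigen a r f ->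
  exists2 z, mpow k n r z & geigen a r.+1 (f + z).
Proof.
move=> f1 [N fN]; have [p p0 pP] := pact_annihilator r.+1.
have [m [q [u [v [pE qa uv]]]]] := split_root a p0.
have /Bezout_eq1_coprimepP[[u' v'] /= uv'] : coprimep q (('X - a%:P) ^+ N).
  by apply: coprimep_expr; rewrite coprimep_XsubC.
set h := act _ f in fN.
exists (- act v' h); first by apply: (@submoduleN _ _ (mpow k n r)); exact: act_mpow.
exists (m + N)%N; rewrite exprD pactM // (linear_mapB _ _ (act_lin (_ ^+ N))) -/h.
have -> : h - act (('X - a%:P) ^+ N) (act v' h) = act (u' * q) h.
  by rewrite -{1}[h](pact1 d) -uv' pactD // -pactM // [_ * v']mulrC addrK.
rewrite -pactM // (_ : _ * _ = u' * p) ?pactM //; last by rewrite pE; ring.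
by apply: act_mpow; exact: pP.
Qed.

(** The primary components of the variables span the linear forms; a basis can be
    selected among them. *)
Lemma geigen_basis : exists (l : 'I_n -> k) (y : 'I_n -> F),
  [/\ forall i, mpow k n 1 (y i), forall i, geigen (l i) 2 (y i) &
      \matrix_i lin (y i) \in unitmx].
Proof.
have [p p0 pP] := pact_annihilator 2.
have /choice[s sP] : forall i, exists s : seq (k * F), var i = \sum_(x <- s) x.2 /\
    forall x, x \in s -> mpow k n 1 x.2 /\ geigen x.1 2 x.2.
  move=> i; have [s sE sP] := @eigen_decomposition k F d (mpow k n 2) (mpow k n 1) p (var i)
    d_lin (@d_mpow 2) (@d_mpow 1) p0 (pP _) (var_mpow k i).
  by exists s.
pose S := flatten [seq s i | i <- enum 'I_n].
have SP x : x \in S -> mpow k n 1 x.2 /\ geigen x.1 2 x.2.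
  by case/flattenP => _ /mapP[i _ ->]; exact: (sP i).2.
pose A := \matrix_(t < size S) lin (nth (0, 0) S t).2.
have A_full : row_full A.
  rewrite -sub1mx; apply/row_subP => i; rewrite row1 -lin_var (sP i).1.
  rewrite (eq_bigr (fun x : k * F => 1 *: x.2)) => [|x _]; last by rewrite scale1r.
  rewrite lin_sum big_seq; apply: summx_sub => x xs; rewrite scale1r.
  have xS : x \in S by apply/flattenP; exists (s i) => //; apply: map_f; rewrite mem_enum.
  have ix : (index x S < size S)%N by rewrite index_mem.
  have -> : lin x.2 = row (Ordinal ix) A by rewrite rowK /= nth_index.
  exact: row_sub.
pose c := fullrankfun A_full.
exists (fun i => (nth (0, 0) S (c i)).1), (fun i => (nth (0, 0) S (c i)).2); split.
- by move=> i; apply: (SP _ _).1; exact: mem_nth.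
- by move=> i; apply: (SP _ _).2; exact: mem_nth.
rewrite (_ : \matrix_i _ = rowsub c A); first exact: fullrowsub_unit.
by apply/row_matrixP => i; rewrite row_rowsub !rowK.
Qed.

Lemma geigen_coordinates : exists (l : 'I_n -> k) (y : 'I_n -> F),
  [/\ forall i, mpow k n 1 (y i), forall i r, geigen (l i) r (y i) &
      \matrix_i lin (y i) \in unitmx].
Proof.
have [l [y0 [y01 y0l y0u]]] := geigen_basis.
pose Q r (y : 'I_n -> F) := (forall i, mpow k n 1 (y i)) /\ forall i, geigen (l i) r (y i).
case: (@successive k n _ Q 2 y0) => [//|r y r2 [y1 yl]|y [y2 yP]].
  have /choice[z zP] : forall i, exists z, mpow k n r z /\ geigen (l i) r.+1 (y i + z).
    by move=> i; have [z zr zl] := geigen_lift (y1 i) (yl i); exists z.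
  exists z; split=> [i|]; first exact: (zP i).1.
  split=> i; last exact: (zP i).2.
  apply: (@submoduleD _ _ (mpow k n 1)) => //; apply: mpow_le (zP i).1; lia.
exists l, y; split.
- move=> i; rewrite -[y i](subrK (y0 i)); apply: (@submoduleD _ _ (mpow k n 1)) => //.
  by apply: mpow_le (y2 i).
- move=> i r; have [z [zr [_ /(_ i) yl]]] := yP (maxn 2 r) (leq_maxl _ _).
  have [N yN] : geigen (l i) (maxn 2 r) (y i).
    rewrite -[y i](addrK (z i)); apply: geigenD => //; apply: geigen_mpow.
    by apply: (@submoduleN _ _ (mpow _ _ _)).
  by exists N; apply: mpow_le yN; exact: leq_maxr.
rewrite (_ : \matrix_i _ = \matrix_i lin (y0 i)) //.
by apply/row_matrixP => i; rewrite !rowK; exact: mpow2_lin.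
Qed.

Variables (l : 'I_n -> k) (y : 'I_n -> F).
Hypotheses (y1 : forall i, mpow k n 1 (y i)) (y_geigen : forall i r, geigen (l i) r (y i)).

Definition weight w : k := \sum_(i <- w) l i.

Lemma geigen_word (s : {lrmorphism F -> F}) (sE : forall i, s (var i) = y i) r w :
  geigen (weight w) r (s (monomial k w)).
Proof.
elim: w => [|i w IHw].
  rewrite monomial0 rmorph1 /weight big_nil; exists 1%N.
  by rewrite expr1 pact_XsubC // der1 scale0r subr0; exact: (submodule0 (mpow _ _ _)).
by rewrite monomial_cons rmorphM /= sE /weight big_cons; exact: geigenM.
Qed.

(** A series fixed by [der g] up to commutators may be replaced by its part of weight one:
    modulo each power of the maximal ideal that part is the image of the series under a
    polynomial [e] in the derivation, and [e] acts as [e.[1] = 1] up to commutators. *)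
Lemma weight_one_part (s : {lrmorphism F -> F}) (sE : forall i, s (var i) = y i) h :
  C (d (s h) - s h) ->
  C (s h - s (fun w => if weight w == 1 then h w else 0)).
Proof.
set h1 : F := fun w => _; move=> fC; apply: cyc0_closed => r.
have /choice[N NP] : forall w, exists N,
    mpow k n r (act (('X - (weight w)%:P) ^+ N) (s (monomial k w))).
  by move=> w; exact: geigen_word.
pose M := (\sum_(w <- words n r) N w).+1.
have NM w : w \in words n r -> (N w <= M)%N.
  by move=> wr; rewrite /M (big_rem w) //=; lia.
pose A : {poly k} := ('X - 1%:P) ^+ M.
pose B : {poly k} := \prod_(w <- words n r | weight w != 1) ('X - (weight w)%:P) ^+ M.
have /Bezout_eq1_coprimepP[[u v] /= uv] : coprimep B A.
  apply: coprimep_expr; rewrite coprimep_XsubC /root horner_prod prodf_seq_neq0.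
  apply/allP => w _; apply/implyP => w1; rewrite horner_exp hornerXsubC expf_neq0 //.
  by rewrite subr_eq0 eq_sym.
pose e := u * B; have e1 : e.[1] = 1.
  have /(congr1 (fun p : {poly k} => p.[1])) := uv.
  by rewrite hornerD !hornerM /A horner_exp hornerXsubC subrr expr0n /= mulr0 addr0 hornerE.
have eU w : w \in words n r ->
    mpow k n r (act e (s (monomial k w)) - (weight w == 1)%:R *: s (monomial k w)).
  move=> wr; have wM := geigen_le (NM w wr) (NP w).
  case: eqP => [w1|/eqP w1].
    have X : s (monomial k w) = act e (s (monomial k w)) + act v (act A (s (monomial k w))).
      by rewrite -(pactM d_lin v A) -pactD [e + _]uv pact1.
    rewrite scale1r {2}X opprD addrA subrr add0r; apply: (@submoduleN _ _ (mpow k n r)).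
    by apply: act_mpow; move: wM; rewrite w1.
  rewrite scale0r subr0 /e /B (big_rem w) //= w1 mulrCA pactM // pactC //.
  by rewrite pactM //; do 2!apply: act_mpow.
exists (s h - act e (s h)).
  rewrite -opprB; apply: (@submoduleN _ _ C).
  have := @pact_eigen _ _ d d_lin e (s h) C 1 (@der_cyc0 k n g).
  by rewrite e1 !scale1r; apply.
have -> : s h - s h1 - (s h - act e (s h)) = act e (s h) - s h1.
  by apply/funext => x; rewrite !(serD, serN); ring.
rewrite -[h](subrK (truncation r h)) -[h1](subrK (truncation r h1)).
have sl := (lrm_ctn s).1; rewrite (linear_mapD (h - _) _ sl) (linear_mapD (h1 - _) _ sl).
rewrite (linear_mapD _ _ (act_lin e)).
have tr h' : mpow k n r (s (h' - truncation r h')).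
  by apply: lrm_mpow; exact: truncation_mpow.
rewrite opprD addrACA; apply: (@submoduleD _ _ (mpow k n r)).
  by apply: (@submoduleB _ _ (mpow k n r)); [apply: act_mpow|]; exact: tr.
rewrite /truncation !(linear_map_sum _ _ _ sl) (linear_map_sum _ _ _ (act_lin e)) -sumrB.
rewrite big_seq; apply: mpow_sum => w wr.
rewrite !(linear_mapZ _ _ sl) (linear_mapZ _ _ (act_lin e)).
have -> : h1 w = h w * (weight w == 1)%:R by rewrite /h1; case: eqP; rewrite ?mulr1 ?mulr0.
by rewrite -scalerA -scalerBr; apply: (@submoduleZ _ _ (mpow k n r)); exact: eU.
Qed.

(** A product of powers of the ['X - (l i)%:P] kills all coordinates modulo [mpow 2],
    hence also an eigenvector of the linear part, on which it acts by its value at the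
    eigenvalue. *)
Lemma eigenvalue_weight (y_unit : \matrix_i lin (y i) \in unitmx) a :
  eigenvalue (\matrix_i lin (g i)) a -> exists i, a = l i.
Proof.
case/eigenvalueP => v va v0; pose f := \sum_i v 0 i *: var i.
have linf : lin f = v.
  by rewrite lin_sum [RHS]row_sum_delta; apply: eq_bigr => i _; rewrite lin_var.
pose P := \matrix_i lin (y i).
pose c := v *m invmx P; pose z := f - \sum_i c 0 i *: y i.
have cP : \sum_i c 0 i *: lin (y i) = v.
  rewrite -[RHS](mulmxKV y_unit) -/P -/c mulmx_sum_row.
  by apply: eq_bigr => i _; rewrite rowK.
have z2 : mpow k n 2 z.
  apply/mpow2; split.
    rewrite /z /f serD serN !ser_sumE !big1 ?subr0 // => i _; rewrite serZ.
      by rewrite y1 ?mulr0.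
    by rewrite /var /monomial mulr0.
  by rewrite /z addrC -scaleN1r lin_linear linf lin_sum cP scaleN1r addNr.
have df : mpow k n 2 (d f - a *: f).
  have -> : d f = \sum_i v 0 i *: g i.
    rewrite (linear_map_sum _ _ _ d_lin); apply: eq_bigr => i _.
    by rewrite (linear_mapZ _ _ d_lin) der_var.
  apply/mpow2; split.
    rewrite /f serD serN serZ !ser_sumE !big1 ?mulr0 ?subr0 // => i _; rewrite serZ.
      by rewrite /var /monomial mulr0.
    by rewrite g1 ?mulr0.
  rewrite addrC -scaleNr lin_linear linf lin_sum.
  have -> : \sum_i v 0 i *: lin (g i) = v *m \matrix_i lin (g i).
    by rewrite mulmx_sum_row; apply: eq_bigr => i _; rewrite rowK.
  by rewrite va scaleNr addNr.
have /choice[N NP] : forall i, exists N, mpow k n 2 (act (('X - (l i)%:P) ^+ N) (y i)).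
  by move=> i; exact: y_geigen.
pose p : {poly k} := \prod_i ('X - (l i)%:P) ^+ N i.
have pf : mpow k n 2 (act p f).
  rewrite -[f](subrK (\sum_i c 0 i *: y i)) -/z (linear_mapD _ _ (act_lin p)).
  apply: (@submoduleD _ _ (mpow k n 2)); first exact: act_mpow.
  rewrite (linear_map_sum _ _ _ (act_lin p)); apply: mpow_sum => i _.
  rewrite (linear_mapZ _ _ (act_lin p)); apply: (@submoduleZ _ _ (mpow k n 2)).
  by rewrite /p (bigD1 i) //= mulrC pactM //; exact: act_mpow.
have pa : mpow k n 2 (p.[a] *: f).
  rewrite -[X in mpow _ _ _ X](subKr (act p f)).
  apply: (@submoduleB _ _ (mpow k n 2)) => //.
  by apply: (@pact_eigen _ _ d d_lin p f (mpow k n 2) a) => // h; exact: d_mpow.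
have p0 : p.[a] = 0.
  have [_] := (mpow2 _).1 pa; rewrite -[_ *: f]addr0 lin_linear linf => /rowP E.
  apply/eqP; apply: contraNT v0 => pa0; apply/eqP/rowP => j; have := E j.
  rewrite !mxE addr0 => /eqP; rewrite mulf_eq0 (negPf pa0) => /eqP //.
move/eqP: p0; rewrite /p horner_prod prodf_seq_eq0 => /hasP[i _ /=].
by rewrite horner_exp hornerXsubC expf_eq0 subr_eq0 => /andP[_ /eqP ->]; exists i.
Qed.

End NormalForm.

(** * Rational weights *)

Section AxisMonomials.
Variables (k : fieldType) (n : nat).
Local Notation F := (ncseries k n).
Local Notation C := (cyc0 k n).
Implicit Types (f h : F) (w : seq 'I_n) (i j : 'I_n).

(** The kernel of the projection killing all variables but [i]. *)
Definition axis_set i f := forall N, f (nseq N i) = 0.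

Lemma axis_set0 i : axis_set i 0. Proof. by []. Qed.

Lemma axis_setP i a f h : axis_set i f -> axis_set i h -> axis_set i (a *: f + h).
Proof. by move=> fi hi N; rewrite serD serZ fi hi mulr0 addr0. Qed.

Definition axis i : submodule F := Submodule (@axis_set0 i) (@axis_setP i).
Arguments axis : simpl never.

Lemma axis_closed i : madic_closed (axis i).
Proof.
move=> f fU N; have [h hi fh] := fU N.+1.
by rewrite -[f](subrK h) serD hi addr0 fh // size_nseq.
Qed.

Lemma axisMl i a h : axis i h -> axis i (a * h).
Proof.
by move=> hi N; rewrite serM big1 // => p _; rewrite drop_nseq hi mulr0.
Qed.

Lemma axisMr i a h : axis i h -> axis i (h * a).
Proof.
move=> hi N; rewrite serM size_nseq big_nat big1 // => p /andP[_ pN].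
by rewrite take_nseq // hi mul0r.
Qed.

(** Otherwise all cyclic derivatives vanish on the axis of [i], and then so does the
    Jacobi ideal; but that ideal contains a power of the variable [i]. The bound
    [2 <= a] comes from the order of [h]. *)
Lemma axis_monomial (s : {lrmorphism F -> F}) f h N i :
  bijective s -> C (f - s h) -> mpow k n 3 h ->
  (forall x, mpow k n N x -> Jac f x) ->
  exists w j a, [/\ h w != 0, (2 <= a)%N & perm_eq w (j :: nseq a i)].
Proof.
move=> /lrm_inverse[t [sK tK]] fh h3 NJ; apply: contrapT => noW.
have hi j : axis i (cycder j h).
  move=> M; rewrite /cycder big1_seq // => p /andP[_].
  rewrite mem_index_iota size_nseq ltnS => pM.
  set w := _ ++ _; have wE : perm_eq w (j :: nseq M i).
    rewrite /w perm_catC /= perm_cons perm_catC.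
    by rewrite perm_sym -{1}[nseq M i](cat_take_drop p) perm_catC.
  have [M2|M2] := ltnP M 2.
    by rewrite h3 // (perm_size wE) /= size_nseq.
  apply/eqP; apply: contrapT => hw; apply: noW; exists w, j, M.
  by split=> //; exact/negP.
have ct := lrm_ctn t; pose U := preim ct.1 (axis i).
have cU : madic_closed U by apply: preim_closed; exact: axis_closed.
have Ul a x : U x -> U (a * x).
  by rewrite /U /= /preim_set rmorphM; exact: axisMl.
have Ur a x : U x -> U (x * a).
  by rewrite /U /= /preim_set rmorphM; exact: axisMr.
have JU : forall x, Jac f x -> U x.
  apply: Jac_min => // j.
  have -> : cycder j f = cycder j (s h).
    by apply/eqP; rewrite -subr_eq0 -cycderB; apply/eqP; exact: cycder_cyc0.
  rewrite cycderE -{1}(rmorph1 s) lrm_dc; apply: (@big_ind _ U).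
  - exact: (submodule0 U).
  - by move=> x z; exact: (@submoduleD _ _ U).
  move=> l _; apply: dc_ideal => //; rewrite /U /= /preim_set sK -cycderE; exact: hi.
have := JU _ (NJ _ (lrm_mpow s (mpow_monomial k (eq_leq (esym (size_nseq N i)))))).
move/(_ N); rewrite sK /monomial eqxx => /eqP; by rewrite oner_eq0.
Qed.

End AxisMonomials.

Lemma ratr_morphism (k : fieldType) : [pchar k] =i pred0 ->
  exists phi : {rmorphism rat -> k}, forall x, phi x = ratr x.
Proof.
move=> hk; have int0 (z : int) : (z%:~R == 0 :> k) = (z == 0).
  have /pcharf0P nat0 := hk.
  by case: z => m; rewrite ?NegzE ?rmorphN ?oppr_eq0 /= -?pmulrn nat0.
have den0 x : (denq x)%:~R != 0 :> k by rewrite int0 denq_neq0.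
have ratrE (a b : int) : b != 0 -> ratr (a%:Q / b%:Q) = a%:~R / b%:~R :> k.
  move=> b0; rewrite /ratr; set x := _ / _.
  apply/eqP; rewrite eqr_div // ?int0 // -!intrM; apply/eqP; congr (_%:~R).
  apply: (intr_inj (R := rat)); rewrite !intrM.
  apply/eqP; rewrite -eqr_div ?intr_eq0 ?denq_neq0 //.
  by rewrite divq_num_den.
have dQ x : (denq x)%:Q != 0 by rewrite intr_eq0 denq_neq0.
have add : {morph (@ratr k) : x y / x + y}.
  move=> x y; rewrite -{1}[x]divq_num_den -{1}[y]divq_num_den addf_div //.
  rewrite -!intrM -intrD ratrE ?mulf_neq0 ?denq_neq0 //.
  by rewrite /ratr addf_div // !intrD !intrM.
have mul : {morph (@ratr k) : x y / x * y}.
  move=> x y; rewrite -{1}[x]divq_num_den -{1}[y]divq_num_den mulf_div.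
  by rewrite -!intrM ratrE ?mulf_neq0 ?denq_neq0 // /ratr mulf_div !intrM.
have r0 : ratr 0 = 0 :> k by rewrite /ratr mul0r.
have r1 : ratr 1 = 1 :> k by rewrite /ratr divr1.
pose A := GRing.isNmodMorphism.Build rat k (@ratr k) (r0, add).
pose M := GRing.isMonoidMorphism.Build rat k (@ratr k) (r1, mul).
pose phi : {rmorphism rat -> k} := HB.pack (@ratr k) A M.
by exists phi.
Qed.

Section WeightSystem.
Variables (n : nat) (J : 'I_n -> 'I_n) (a : 'I_n -> nat).
Hypothesis a2 : forall i, (2 <= a i)%N.
Import Num.Theory Order.TTheory.

(** Let [m] and [M] be the extreme values of [r]. The equations at the extremal indices
    give [M >= 1 - 2 * m] if [m <= 0], and [2 * M + m <= 1] if [M >= 0]; together they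
    exclude [m <= 0], and then [2 * M < 1]. *)
Lemma weight_system_bound (r : 'I_n -> rat) :
  (forall i, r i *+ a i + r (J i) = 1) -> forall i, 0 < r i < 2^-1.
Proof.
move=> rE i0.
have [i _ imin] := arg_minP r (isT : predT i0).
have [j _ jmax] := arg_maxP r (isT : predT i0).
have a2r l : 2 <= (a l)%:R :> rat by rewrite (ler_nat _ 2).
have Ei := rE i; have Ej := rE j; rewrite -mulr_natr in Ei; rewrite -mulr_natr in Ej.
have := imin (J j) isT; have := jmax (J i) isT; have := imin i0 isT; have := jmax i0 isT.
have := imin j isT.
move: (a2r i) (a2r j) Ei Ej; move: (r i) (r j) (r (J i)) (r (J j)) (r i0) (a i)%:R (a j)%:R.
move=> m M rJi rJj x A B A2 B2 Ei Ej mM xM mx rJiM mrJj.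
have {}xM : x <= M := xM; have {}rJiM : rJi <= M := rJiM.
have m0 : 0 < m.
  rewrite ltNge; apply/negP => m0.
  have h1 : 0 <= (- m) * (A - 2) by rewrite mulr_ge0 //; lra.
  have M0 : 0 <= M by lra.
  have h2 : 0 <= M * (B - 2) by rewrite mulr_ge0 //; lra.
  lra.
have M2 : M < 2^-1.
  have h2 : 0 <= M * (B - 2) by rewrite mulr_ge0 //; lra.
  lra.
apply/andP; split; lra.
Qed.

(** The matrix of the system has rational entries and is invertible, as an entry of
    maximal absolute value of a kernel vector must vanish. *)
Lemma weight_system_rational (k : fieldType) (phi : {rmorphism rat -> k}) (l : 'I_n -> k) :
  (forall i, l i *+ a i + l (J i) = 1) ->
  exists2 r : 'I_n -> rat, (forall i, 0 < r i < 2^-1) & forall i, l i = phi (r i).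
Proof.
move=> lE; pose B := \matrix_(j < n, i < n) ((j == i)%:R *+ a i + (j == J i)%:R) : 'M[rat]_n.
have mulB (K : fieldType) (psi : {rmorphism rat -> K}) (v : 'rV[K]_n) i :
    (v *m map_mx psi B) 0 i = v 0 i *+ a i + v 0 (J i).
  rewrite mxE; under eq_bigr => j _ do
    rewrite !mxE rmorphD rmorphMn !rmorph_nat mulrDr mulrnAr.
  rewrite big_split /= (bigD1 i) //= eqxx mulr1 big1 ?addr0; last first.
    by move=> j /negPf ->; rewrite mulr0 mul0rn.
  rewrite (bigD1 (J i)) //= eqxx mulr1 big1 ?addr0 // => j /negPf ->.
  by rewrite mulr0.
have Bu : B \in unitmx.
  rewrite unitmxE unitfE; apply/det0P => -[v v0 vB].
  have vE i : v 0 i *+ a i + v 0 (J i) = 0.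
    have := mulB _ (GRing.RMorphism.clone rat rat idfun _) v i.
    by rewrite map_mx_id // vB mxE.
  case/eqP: v0; apply/rowP => i0; rewrite mxE.
  have [i _ imax] := arg_maxP (fun i => `|v 0 i|) (isT : predT i0).
  have i0i : `|v 0 i0| <= `|v 0 i| := imax i0 isT.
  have Ji : `|v 0 (J i)| <= `|v 0 i| := imax (J i) isT.
  have /eqP := vE i; rewrite addrC addr_eq0 => /eqP /(congr1 Num.norm).
  rewrite normrN normrMn -mulr_natr => JE.
  have a2i : 2 <= (a i)%:R :> rat by rewrite (ler_nat _ 2).
  have ge0 : 0 <= `|v 0 i| * ((a i)%:R - 2) by rewrite mulr_ge0 // subr_ge0.
  by apply/eqP; rewrite -normr_le0; lra.
pose r := const_mx 1 *m invmx B : 'rV[rat]_n.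
have rE i : r 0 i *+ a i + r 0 (J i) = 1.
  have := mulB _ (GRing.RMorphism.clone rat rat idfun _) r i.
  by rewrite map_mx_id // /r mulmxKV // mxE.
move: (r) rE => {}r rE; exists (fun i => r 0 i); first exact: weight_system_bound.
have Bku : map_mx phi B \in unitmx by rewrite map_unitmx.
move=> i; have : \row_i l i = map_mx phi r.
  apply: (can_inj (mulmxK Bku)); apply/rowP => j.
  by rewrite !mulB !mxE lE -rmorphMn -rmorphD rE rmorph1.
by move/rowP/(_ i); rewrite !mxE.
Qed.

End WeightSystem.

(** * Uniqueness of the spectrum *)

Section RationalSpectrum.
Variables (k : closedFieldType) (phi : {rmorphism rat -> k}) (n : nat).
Implicit Types (A B : 'M[k]_n).

Definition rational_spectrum A :=
  forall a, eigenvalue A a -> exists q : rat, a = phi q.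

Lemma det_rational A (c : rat) : rational_spectrum A ->
  exists q, \det ((phi c)%:M - A) = phi q.
Proof.
move=> ratA.
have -> : \det ((phi c)%:M - A) = (char_poly A).[phi c].
  rewrite -horner_evalE /char_poly -det_map_mx; congr (\det _).
  apply/matrixP => i j; rewrite /char_poly_mx !mxE /= /horner_eval hornerD hornerN hornerC.
  by rewrite hornerMn hornerX.
have [rs pE] := closed_field_poly_normal (char_poly A).
have lc : lead_coef (char_poly A) = 1 by apply/eqP; exact: char_poly_monic.
have rsE a : a \in rs -> exists q, a = phi q.
  move=> ars; apply: (ratA a); rewrite eigenvalue_root_char pE lc scale1r root_prod_XsubC.
  exact: ars.
rewrite pE lc scale1r horner_prod big_seq; apply: (@big_ind _ (fun x => exists q, x = phi q)).
- by exists 1; rewrite rmorph1.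
- by move=> _ _ [q ->] [q' ->]; exists (q * q'); rewrite rmorphM.
by move=> a /rsE[q ->]; exists (c - q); rewrite hornerXsubC rmorphB.
Qed.

(** A polynomial over an algebraically closed field takes every value unless it is
    constant; it cannot take rational values only, as [-1] is not a square in [rat]. *)
Lemma rational_valued_const (p : {poly k}) :
  (forall t, exists q, p.[t] = phi q) -> p.[0] = p.[1].
Proof.
move=> pQ; have [/size1_polyC ->|p1] := leqP (size p) 1.
  by rewrite !hornerC.
have [|i i2] := closed_rootP ('X^2 + 1 : {poly k}) _.
  by rewrite size_polyDl ?size_polyXn ?size_poly1.
have [|t] := closed_rootP (p - i%:P) _.
  by rewrite size_polyDl ?size_polyN ?(leq_ltn_trans (size_polyC_leq1 _)) // gtn_eqF.
have [q qE] := pQ t; rewrite /root hornerD hornerN hornerC qE subr_eq0 => /eqP iq.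
move: i2; rewrite -iq /root hornerD hornerXn hornerE -rmorphXn -(rmorph1 phi) -rmorphD.
rewrite fmorph_eq0 => /eqP q2; have q0 : 0 <= q ^+ 2 := Num.Theory.sqr_ge0 q.
by exfalso; clear -q0 q2; lra.
Qed.

(** The determinant for [(1 - t) *: A + t *: B] is a polynomial in [t] with rational
    values only. *)
Lemma pencil_det A B (c : rat) :
  (forall t : k, rational_spectrum ((1 - t) *: A + t *: B)) ->
  \det ((phi c)%:M - A) = \det ((phi c)%:M - B).
Proof.
move=> ratAB.
pose M : 'M[{poly k}]_n := map_mx polyC ((phi c)%:M - A) - 'X *: map_mx polyC (B - A).
have ME t : (\det M).[t] = \det ((phi c)%:M - ((1 - t) *: A + t *: B)).
  rewrite -horner_evalE -det_map_mx; congr (\det _).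
  apply/matrixP => i j; rewrite !mxE /= /horner_eval !hornerE; ring.
have := rational_valued_const (p := \det M); rewrite !ME.
rewrite subr0 scale1r scale0r addr0 subrr scale0r add0r scale1r; apply => t.
by rewrite ME; exact: det_rational.
Qed.

End RationalSpectrum.

Lemma prod_sub_perm n (r r' : 'I_n -> rat) :
  (forall c, \prod_i (c - r i) = \prod_i (c - r' i)) ->
  exists s : {perm 'I_n}, forall i, r' i = r (s i).
Proof.
move=> rE; pose p (u : 'I_n -> rat) := \prod_(x <- [tuple u i | i < n]) ('X - x%:P).
have pE : p r' = p r.
  apply/eqP; rewrite -subr_eq0; apply/eqP; set q := _ - _.
  apply: (@roots_geq_poly_eq0 _ q [seq m%:R | m <- iota 0 (size q)]).
  - apply/allP => _ /mapP[m _ ->]; rewrite /root /q hornerD hornerN !horner_prod.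
    rewrite !big_tuple; under eq_bigr => i _ do rewrite tnth_mktuple hornerXsubC.
    under [X in _ - X]eq_bigr => i _ do rewrite tnth_mktuple hornerXsubC.
    by rewrite rE subrr.
  - rewrite map_inj_uniq ?iota_uniq // => x y /eqP.
    by rewrite Num.Theory.eqr_nat => /eqP.
  by rewrite size_map size_iota.
have /tuple_permP[s sE] : perm_eq [tuple r' i | i < n] [tuple r i | i < n].
  exact: prod_XsubC_eq.
exists s => i; have := congr1 (fun u => tnth u i) (val_inj sE).
by rewrite !tnth_mktuple.
Qed.

(** * Weighted-homogeneous superpotentials *)

Section BoundedWords.
Import Num.Theory Order.TTheory.

(** Positive weights are bounded below, so words of weight one have bounded length. *)
Lemma bounded_word_size n (r : 'I_n -> rat) : (forall i, 0 < r i < 2^-1) ->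
  exists L, forall w : seq 'I_n, \sum_(i <- w) r i = 1 -> (size w <= L)%N.
Proof.
move=> r0; pose b i := Num.bound (r i)^-1; exists (\sum_i b i)%N => w w1.
set L := (\sum_i b i)%N.
have rL i : 1 <= r i * L%:R.
  have /andP[ri _] := r0 i.
  have rb : (r i)^-1 < (b i)%:R by apply: archi_boundP; rewrite invr_ge0 ltW.
  have bL : (b i)%:R <= L%:R :> rat by rewrite ler_nat /L (bigD1 i) //= leq_addr.
  by rewrite -[leLHS](mulfV (lt0r_neq0 ri)) ler_pM2l // (le_trans (ltW rb)).
have -> : (size w <= L)%N = (\sum_(i <- w) 1 <= \sum_(i <- w) r i * L%:R :> rat).
  rewrite -mulr_suml w1 mul1r -(ler_nat rat); congr (_ <= _).
  by elim: (w) => [|i v IHv]; rewrite ?big_nil // big_cons -IHv /= mulrS.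
by apply: ler_sum => i _.
Qed.

End BoundedWords.

Section Final.
Variables (k : closedFieldType) (n : nat) (phi : {rmorphism rat -> k}).
Local Notation F := (ncseries k n).
Local Notation C := (cyc0 k n).
Implicit Types (f h : F) (w : seq 'I_n) (i j : 'I_n) (g : 'I_n -> F) (r : 'I_n -> rat).

(** Saito's normal form. The rational weights also account for all eigenvalues of the
    linear part of the derivation, which is what uniqueness needs. *)
Lemma euler_normal_form f g N :
  (forall i, mpow k n 1 (g i)) -> C (der g f - f) -> mpow k n 3 f ->
  (forall x, mpow k n N x -> Jac f x) ->
  exists r (s : {lrmorphism F -> F}) h,
    [/\ forall i, 0 < r i < 2^-1, bijective s, C (f - s h),
        forall w, h w != 0 -> \sum_(i <- w) r i = 1 &
        forall a, eigenvalue (\matrix_i lin (g i)) a -> exists i, a = phi (r i)].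
Proof.
move=> g1 gf f3 NJ; have [l [y [y1 yl yu]]] := geigen_coordinates g1.
have [s bs sE] := subst_bij y1 yu; have [t [sK tK]] := lrm_inverse bs.
pose h : F := fun w => if weight l w == 1 then t f w else 0.
have fh : C (f - s h).
  by have := @weight_one_part k n g g1 l y yl s sE (t f); rewrite tK; apply.
have h3 : mpow k n 3 h.
  by move=> w w3; rewrite /h (lrm_mpow t f3) // if_same.
have hl w : h w != 0 -> weight l w = 1.
  by rewrite /h; case: ifP => [/eqP//|_] /eqP.
have /choice[J /choice[a aP]] : forall i, exists j a, (2 <= a)%N /\ l i *+ a + l j = 1.
  move=> i; have [w [j [a [hw a2 wE]]]] := axis_monomial i bs fh h3 NJ.
  exists j, a; split=> //; have := hl w hw.
  by rewrite /weight (perm_big _ wE) /= big_cons big_nseq iter_addr_0 addrC.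
have [r r0 lr] := weight_system_rational (fun i => (aP i).1) phi (fun i => (aP i).2).
exists r, s, h; split=> // [w /hl|a' ea].
  rewrite /weight; under eq_bigr => i _ do rewrite lr.
  by rewrite -rmorph_sum -(rmorph1 phi) => /fmorph_inj.
have [i ->] := eigenvalue_weight g1 y1 yl yu ea; by exists i.
Qed.

Lemma euler_right_equivalent f r (s : {lrmorphism F -> F}) h :
  (forall i, 0 < r i < 2^-1) -> bijective s -> C (f - s h) ->
  (forall w, h w != 0 -> \sum_(i <- w) r i = 1) ->
  exists2 Psi, weighted_homogeneous r Psi & right_equivalent (cproj f) Psi.
Proof.
move=> r0 bs fh hr; have [t [sK tK]] := lrm_inverse bs; exists (cproj h).
  split=> [i|]; first by have /andP[-> /Order.POrderTheory.ltW] := r0 i.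
  exists h => //; have [L LP] := bounded_word_size r0.
  have -> : h = truncation L.+1 h.
    apply/eqP; rewrite -subr_eq0; apply/eqP/funext => w.
    have [wL|Lw] := ltnP (size w) L.+1; first exact: truncation_mpow.
    have hw v : (L < size v)%N -> h v = 0.
      by move=> Lv; apply/eqP; apply: contraTT Lv => /hr /LP; rewrite -leqNgt.
    rewrite serD serN /truncation ser_sumE hw // big1_seq ?subr0 // => v /andP[_].
    rewrite mem_words => vL; rewrite serZ /monomial; case: eqP => [wv|]; rewrite ?mulr0 //.
    by move: vL; rewrite -wv ltnNge Lw.
  set S := Defs.span _; apply: (@big_ind _ S); first exact: (submodule0 S).
    by move=> x y; exact: (@submoduleD _ _ S).
  move=> w _; have [->|hw] := eqVneq (h w) 0.
    by rewrite scale0r; exact: (submodule0 S).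
  apply: (@submoduleZ _ _ S); apply: Defs.sub_span; exists w => //=; exact: hr.
exists t; first by exists s.
rewrite ser_aut_actE; apply/cproj_eq; rewrite -opprB; apply: (@submoduleN _ _ C).
by have := lrm_cyc0 t fh; rewrite raddfB /= sK.
Qed.

Lemma lin_map (A : F -> F) f : linear A -> (forall x, mpow k n 2 x -> mpow k n 2 (A x)) ->
  mpow k n 1 f -> lin (A f) = lin f *m \matrix_i lin (A (var i)).
Proof.
move=> lA A2 f1; have D : mpow k n 2 (f - \sum_i f [:: i] *: var i).
  apply/mpow2; split.
    rewrite serD serN ser_sumE f1 // big1 ?subr0 // => i _.
    by rewrite serZ /var /monomial mulr0.
  rewrite addrC -scaleN1r lin_linear lin_sum scaleN1r addrC; apply/eqP.
  rewrite subr_eq0; apply/eqP; rewrite [LHS]row_sum_delta.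
  by apply: eq_bigr => i _; rewrite lin_var mxE.
have := A2 _ D; rewrite (linear_mapB _ _ lA) => /mpow2_lin ->.
rewrite (linear_map_sum _ _ _ lA) mulmx_sum_row.
under eq_bigr => i _ do rewrite (linear_mapZ _ _ lA).
by rewrite lin_sum; apply: eq_bigr => i _; rewrite rowK mxE.
Qed.

(** The Euler derivation of a weighted-homogeneous form of [f], transported back by the
    automorphism. Its linear part is conjugate to the diagonal matrix of weights. *)
Lemma weighted_euler f r (Psi : superpotential k n) :
  weighted_homogeneous r Psi -> right_equivalent (cproj f) Psi ->
  exists g, [/\ forall i, mpow k n 1 (g i), C (der g f - f) &
    forall c, \det (c%:M - \matrix_i lin (g i)) = \prod_i (c - phi (r i))].
Proof.
case=> _ [e eS ->] [s bs]; rewrite ser_aut_actE => /cproj_eq es.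
have [t [sK tK]] := lrm_inverse bs.
pose E := der (fun i => phi (r i) *: var i : F).
have lE : linear E by exact: (der_ctn _).1.
have Er i : mpow k n 1 (phi (r i) *: var i).
  by apply: (@submoduleZ _ _ (mpow k n 1)); exact: var_mpow.
have Ew w : E (monomial k w) = phi (\sum_(i <- w) r i) *: monomial k w.
  elim: w => [|i w IHw]; first by rewrite /E monomial0 der1 big_nil rmorph0 scale0r.
  rewrite /E der_monomial_cons -/E IHw big_cons rmorphD scalerDl monomial_cons.
  by rewrite scalerAl scalerAr.
have Ee : E e = e.
  case: eS => u uS ->; rewrite (linear_map_sum _ _ _ lE); apply: eq_big_seq => p /uS[w /= w1 <-].
  by rewrite (linear_mapZ _ _ lE) Ew w1 rmorph1 scale1r.
pose X x := t (E (s x)).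
have lX : linear X by move=> a x z; rewrite /X (lrm_ctn s).1 lE (lrm_ctn t).1.
have XE : forall x, X x = der (fun i => X (var i)) x.
  apply: derivation_der => // x z.
  by rewrite /X rmorphM /= /E derM raddfD /= !rmorphM /= !sK.
have sv i : mpow k n 1 (s (var i)) by apply: lrm_mpow; exact: var_mpow.
exists (fun i => X (var i)); split.
- by move=> i; apply: lrm_mpow; apply: der_mpow.
- rewrite -XE; have fe : C (s f - e) by rewrite -opprB; exact: (@submoduleN _ _ C).
  have Efe : C (E (s f) - e) by rewrite -{1}Ee -(linear_mapB _ _ lE); exact: der_cyc0.
  have := lrm_cyc0 t (@submoduleB _ _ C _ _ Efe fe).
  by rewrite opprB addrA subrK raddfB /= sK.
move=> c; pose S := \matrix_i lin (s (var i)); pose T := \matrix_i lin (t (var i)).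
pose D := diag_mx (\row_i phi (r i)).
have ST : S *m T = 1%:M.
  apply/row_matrixP => i; rewrite row_mul rowK row1 -lin_var -{2}(sK (var i)).
  by rewrite [RHS]lin_map // => [|x]; [exact: (lrm_ctn t).1|exact: lrm_mpow].
have -> : \matrix_i lin (X (var i)) = S *m D *m T.
  apply/row_matrixP => i; rewrite !row_mul !rowK.
  have Es1 : mpow k n 1 (E (s (var i))) by exact: der_mpow.
  rewrite [LHS](lin_map (lrm_ctn t).1 (@lrm_mpow _ _ t 2) Es1).
  congr (_ *m _); rewrite (lin_map lE (fun x => @der_mpow k n _ 2 x Er) (sv i)).
  congr (_ *m _); apply/row_matrixP => j; rewrite rowK /E der_var.
  rewrite -[_ *: _]addr0 lin_linear lin_var; apply/rowP => l; rewrite !mxE addr0.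
  by rewrite eqxx /= eq_sym mulr_natr.
have -> : c%:M - S *m D *m T = S *m (c%:M - D) *m T.
  by rewrite mulmxBr mulmxBl mul_mx_scalar -scalemxAl ST scalemx1.
rewrite !det_mulmx mulrAC -det_mulmx ST det1 mul1r.
have -> : c%:M - D = diag_mx (\row_i (c - phi (r i))).
  by apply/matrixP => i j; rewrite !mxE; case: eqP; rewrite ?mulr1n ?mulr0n ?subr0.
by rewrite det_diag; apply: eq_bigr => i _; rewrite mxE.
Qed.

Lemma weights_unique f N r r' (Psi Psi' : superpotential k n) :
  mpow k n 3 f -> (forall x, mpow k n N x -> Jac f x) ->
  weighted_homogeneous r Psi -> right_equivalent (cproj f) Psi ->
  weighted_homogeneous r' Psi' -> right_equivalent (cproj f) Psi' ->
  exists s : {perm 'I_n}, forall i, r' i = r (s i).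
Proof.
move=> f3 NJ hr er hr' er'.
have [g [g1 gf gD]] := weighted_euler hr er.
have [g' [g1' gf' gD']] := weighted_euler hr' er'.
apply: prod_sub_perm => c; apply: (fmorph_inj phi); rewrite !rmorph_prod.
under eq_bigr => i _ do rewrite rmorphB; rewrite -gD.
under [RHS]eq_bigr => i _ do rewrite rmorphB; rewrite -gD'.
apply: pencil_det => t a.
have -> : (1 - t) *: \matrix_i lin (g i) + t *: \matrix_i lin (g' i) =
    \matrix_i lin ((1 - t) *: g i + t *: g' i).
  by apply/matrixP => i j; rewrite !mxE.
pose gt i := (1 - t) *: g i + t *: g' i.
have gt1 i : mpow k n 1 (gt i).
  apply: (@submoduleP _ _ (mpow k n 1)) => //.
  exact: (@submoduleZ _ _ (mpow k n 1)).
have gtf : C (der gt f - f).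
  rewrite der_comb.
  have := @submoduleP _ _ C (1 - t) _ _ gf (@submoduleZ _ _ C t _ gf'); congr (C _).
  by apply/funext => u; rewrite !(serD, serN, serZ); ring.
have [q [s [h [_ _ _ _ eP]]]] := euler_normal_form gt1 gtf f3 NJ.
by move=> /eP[i ->]; exists (q i).
Qed.

End Final.

Theorem theorem1p2 (k : closedFieldType) (hk : [pchar k] =i pred0)
  (n : nat) (hn : (0 < n)%N) (Phi : superpotential k n)
  (hord : order_ge 3 Phi)
  (hfin : finite_dimensional (jacobi_algebra Phi)) :
  (quasi_homogeneous Phi <->
     exists r : 'I_n -> rat,
       (forall i, 0 < r i < 2^-1) /\
       exists2 Psi : superpotential k n,
         weighted_homogeneous r Psi & right_equivalent Phi Psi) /\
  (quasi_homogeneous Phi ->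
     forall r r' : 'I_n -> rat,
       (forall i, 0 < r i < 2^-1) ->
       (exists2 Psi : superpotential k n,
          weighted_homogeneous r Psi & right_equivalent Phi Psi) ->
       (forall i, 0 < r' i < 2^-1) ->
       (exists2 Psi : superpotential k n,
          weighted_homogeneous r' Psi & right_equivalent Phi Psi) ->
       exists s : {perm 'I_n}, forall i, r' i = r (s i)).
Proof.
case: hord hfin => f /ideal_powE f3 -> /mpow_Jac[N NJ].
have [phi _] := ratr_morphism hk.
split; last first.
  move=> _ r r' _ [Psi hr er] _ [Psi' hr' er'].
  exact: (weights_unique phi f3 NJ hr er hr' er').
split=> [qf|[r [_ [Psi hr er]]]]; last first.
  by have [g [_ gf _]] := weighted_euler phi hr er; exact: euler_quasi_homogeneous NJ gf.
have [g gf] := euler_exists NJ qf.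
have g1 : forall i, mpow k n 1 (g i).
  by apply: (euler_mpow1 hk NJ) gf; exact: mpow_le f3.
have [r [s [h [r0 bs fh hr _]]]] := euler_normal_form phi g1 gf f3 NJ.
by exists r; split=> //; exact: euler_right_equivalent r0 bs fh hr.
Qed.
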